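(* For every relatively prime pair of integers $p>q\ge1$, the lens space $L(p,q)$ admits a nondegenerate contact form with only two simple closed Reeb orbits, both of them nondegenerate and noncontractible.
   Context: $L(p,q)=S^3/G_{p,q}$, where $G_{p,q}\subset U(2)$ is the cyclic group of matrices $\begin{pmatrix}e^{2\pi ik/p}&0\\0&e^{2\pi ikq/p}\end{pmatrix}$, $k\in\mathbb{Z}_p$, acting on the unit sphere $S^3\subset\mathbb{C}^2$. The Reeb vector field of a contact form $\alpha$ is defined by $d\alpha(R_\alpha,\cdot)=0$, $\alpha(R_\alpha)=1$. Closed orbits $\gamma:\mathbb{R}/\mathbb{Z}\to M$ satisfy $\dot\gamma=TR_\alpha(\gamma)$ with $T>0$, are regarded up to parametrization, and are simple if not multiple covers of other closed orbits; an orbit is nondegenerate if the linearized time-$T$ Reeb flow on $\ker\alpha$ along it has no eigenvalue $1$. A contact form is nondegenerate if all closed orbits (including multiple covers) are nondegenerate. *)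

(* Defs.v *)
From HB Require Import structures.
From mathcomp Require Import all_boot all_order all_algebra generic_quotient.
From mathcomp Require Import all_classical all_reals all_analysis.
From mathcomp Require Import ring.

Set Implicit Arguments.
Unset Strict Implicit.
Unset Printing Implicit Defensive.

Import Order.TTheory GRing.Theory Num.Theory.
Import numFieldNormedType.Exports.

Local Open Scope classical_set_scope.
Local Open Scope ring_scope.

(** * Manifolds, given by an atlas *)

(* C^oo on a neighbourhood of every point of U: all iterated directional
   derivatives exist and are differentiable there. *)
Definition smooth_on (R : realType) (V W : normedModType R) (U : set V)
    (f : V -> W) : Prop :=
  forall (vs : seq V) (x : V), U x ->
    differentiable (foldr (fun v g => 'D_v g) f vs) x.

(* [cfun] and [cinv] only matter on [cdom] and on [cimg] respectively. *)
Record chart (R : realType) (M : Type) (n : nat) := Chart {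
  cdom : set M;
  cfun : M -> 'rV[R]_n;
  cinv : 'rV[R]_n -> M }.

Definition cimg (R : realType) (M : Type) (n : nat) (c : chart R M n) :
  set 'rV[R]_n := cfun c @` cdom c.

Definition homeo_chart (R : realType) (M : topologicalType) (n : nat)
    (c : chart R M n) : Prop :=
  [/\ open (cdom c), open (cimg c),
      (forall m, cdom c m -> cinv c (cfun c m) = m),
      (forall m, cdom c m -> {for m, continuous (cfun c)}) &
      (forall y, cimg c y -> {for y, continuous (cinv c)})].

Definition transition (R : realType) (M : Type) (n : nat)
  (c d : chart R M n) : 'rV[R]_n -> 'rV[R]_n := cfun d \o cinv c.

(** * Contact forms and Reeb dynamics *)

Definition pairing (R : realType) (n : nat) (a : 'cV[R]_n) (v : 'rV[R]_n) : R :=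
  (v *m a) 0 0.

(* The local expressions of a differential 1-form: [a c y] is the covector at
   the point of coordinates [y] in the chart [c]. *)
Definition local_forms (R : realType) (M : Type) (n : nat) :=
  chart R M n -> 'rV[R]_n -> 'cV[R]_n.

Definition one_form (R : realType) (M : Type) (n : nat)
    (A : set (chart R M n)) (a : local_forms R M n) : Prop :=
  (forall c, A c -> smooth_on (cimg c) (a c)) /\
  (forall c d, A c -> A d -> forall m, cdom c m -> cdom d m -> forall v,
     pairing (a c (cfun c m)) v =
     pairing (a d (cfun d m)) ('d (transition c d) (cfun c m) v)).

(* d a (u, v) in the chart c, with u and v extended as constant fields. *)
Definition dform (R : realType) (M : Type) (n : nat) (a : local_forms R M n)
    (c : chart R M n) (y u v : 'rV[R]_n) : R :=
  'D_u (fun z => pairing (a c z) v) y - 'D_v (fun z => pairing (a c z) u) y.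

(* (a /\ d a) (e_0, e_1, e_2) in the chart c. *)
Definition contact_volume (R : realType) (M : Type) (a : local_forms R M 3)
    (c : chart R M 3) (y : 'rV[R]_3) : R :=
  let e (i : 'I_3) : 'rV[R]_3 := delta_mx 0 i in
  let i0 : 'I_3 := inord 0 in
  let i1 : 'I_3 := inord 1 in
  let i2 : 'I_3 := inord 2 in
  pairing (a c y) (e i0) * dform a c y (e i1) (e i2) +
  pairing (a c y) (e i1) * dform a c y (e i2) (e i0) +
  pairing (a c y) (e i2) * dform a c y (e i0) (e i1).

Definition contact_form (R : realType) (M : Type)
    (A : set (chart R M 3)) (a : local_forms R M 3) : Prop :=
  one_form A a /\
  (forall c, A c -> forall y, cimg c y -> contact_volume a c y != 0).

Definition reeb_vector (R : realType) (M : Type) (a : local_forms R M 3)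
    (c : chart R M 3) (y w : 'rV[R]_3) : Prop :=
  (forall v, dform a c y w v = 0) /\ pairing (a c y) w = 1.

(* g' = T R_a(g). *)
Definition reeb_curve (R : realType) (M : topologicalType)
    (A : set (chart R M 3)) (a : local_forms R M 3) (T : R) (g : R -> M) :
    Prop :=
  continuous g /\
  (forall (t : R) c, A c -> cdom c (g t) ->
     exists2 w, reeb_vector a c (cfun c (g t)) w &
                is_derive t 1 (cfun c \o g) (T *: w)).

(* Maps out of R/Z are 1-periodic maps out of R. *)
Definition closed_orbit (R : realType) (M : topologicalType)
    (A : set (chart R M 3)) (a : local_forms R M 3) (T : R) (g : R -> M) :
    Prop :=
  [/\ 0 < T, (forall t, g (t + 1) = g t) & reeb_curve A a T g].

(* Both orbits having constant speed along the Reeb field, reparametrizations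
   of the circle amount to shifts of the parameter. *)
Definition same_orbit (R : realType) (M : Type) (g h : R -> M) : Prop :=
  exists s : R, forall t, h t = g (t + s).

Definition simple_orbit (R : realType) (M : topologicalType)
    (A : set (chart R M 3)) (a : local_forms R M 3) (g : R -> M) : Prop :=
  ~ exists (T : R) (h : R -> M) (k : nat),
      [/\ closed_orbit A a T h, (2 <= k)%N & forall t, g t = h (k%:R * t)].

Definition simple_closed_orbit (R : realType) (M : topologicalType)
    (A : set (chart R M 3)) (a : local_forms R M 3) (T : R) (g : R -> M) :
    Prop :=
  closed_orbit A a T g /\ simple_orbit A a g.

Definition reeb_flow (R : realType) (M : topologicalType)
    (A : set (chart R M 3)) (a : local_forms R M 3) (Phi : R -> M -> M) :
    Prop :=
  forall m, Phi 0 m = m /\ reeb_curve A a 1 (Phi ^~ m).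

(* 1 is not an eigenvalue of the differential of the time-T flow, restricted to
   ker a, at the base point g 0 of the orbit. *)
Definition nondegenerate_orbit (R : realType) (M : topologicalType)
    (A : set (chart R M 3)) (a : local_forms R M 3) (T : R) (g : R -> M) :
    Prop :=
  exists2 Phi : R -> M -> M, reeb_flow A a Phi &
    forall c, A c -> cdom c (g 0) ->
      let y := cfun c (g 0) in
      differentiable (cfun c \o Phi T \o cinv c) y /\
      ~ exists v : 'rV[R]_3,
          [/\ v != 0, pairing (a c y) v = 0 &
              'd (cfun c \o Phi T \o cinv c) y v = v].

Definition nondegenerate_form (R : realType) (M : topologicalType)
    (A : set (chart R M 3)) (a : local_forms R M 3) : Prop :=
  forall T g, closed_orbit A a T g -> nondegenerate_orbit A a T g.

Definition contractible_loop (R : realType) (M : topologicalType)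
    (g : R -> M) : Prop :=
  exists (H : R * R -> M) (m : M),
    [/\ {within `[0, 1] `*` [set: R], continuous H},
        (forall s t, 0 <= s <= 1 -> H (s, t + 1) = H (s, t)),
        (forall t, H (0, t) = g t) &
        (forall t, H (1, t) = m)].

(** * Lens spaces *)

(* C^2 is R^4, with coordinates (Re z_1, Im z_1, Re z_2, Im z_2). *)
Definition sphere3 (R : realType) : set 'rV[R]_4 :=
  [set x | \sum_(i < 4) x 0 i ^+ 2 = 1].
Arguments sphere3 R : clear implicits.

(* The action of diag (e^(i s), e^(i t)). *)
Definition diag_rot (R : realType) (s t : R) (x : 'rV[R]_4) : 'rV[R]_4 :=
  let x1 := x 0 (inord 0) in
  let y1 := x 0 (inord 1) in
  let x2 := x 0 (inord 2) in
  let y2 := x 0 (inord 3) in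
  \row_(j < 4) nth 0 [:: cos s * x1 - sin s * y1; sin s * x1 + cos s * y1;
                         cos t * x2 - sin t * y2; sin t * x2 + cos t * y2] j.

Definition lens_act (R : realType) (p q : nat) (k : int) :
    'rV[R]_4 -> 'rV[R]_4 :=
  diag_rot (2 * pi * k%:~R / p%:R) (2 * pi * k%:~R * q%:R / p%:R).

Definition lens_rel (R : realType) (p q : nat) : rel (sphere3 R) :=
  fun x y => `[< exists k : int, \val y = lens_act p q k (\val x) >].

Lemma diag_rot0 (R : realType) (x : 'rV[R]_4) : diag_rot 0 0 x = x.
Proof.
apply/rowP => j; rewrite mxE cos0 sin0 !mul0r !mul1r !subr0 !add0r.
by case: j => [[|[|[|[|//]]]] hj] /=; congr (x 0 _); apply/val_inj;
  rewrite /= inordK.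
Qed.

Lemma diag_rotD (R : realType) (s t s' t' : R) (x : 'rV[R]_4) :
  diag_rot s t (diag_rot s' t' x) = diag_rot (s + s') (t + t') x.
Proof.
apply/rowP => j; rewrite !mxE !inordK //= !cosD !sinD.
by case: j => [[|[|[|[|//]]]] hj] /=; ring.
Qed.

Lemma lens_actD (R : realType) (p q : nat) (k l : int) (x : 'rV[R]_4) :
  lens_act p q k (lens_act p q l x) = lens_act p q (k + l) x.
Proof. by rewrite /lens_act diag_rotD intrD; congr (diag_rot _ _ x); ring. Qed.

Lemma lens_act0 (R : realType) (p q : nat) (x : 'rV[R]_4) :
  lens_act p q 0 x = x.
Proof. by rewrite /lens_act mulr0 !mul0r diag_rot0. Qed.

Lemma lens_rel_refl (R : realType) (p q : nat) : reflexive (@lens_rel R p q).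
Proof. by move=> x; apply/asboolP; exists 0; rewrite lens_act0. Qed.

Lemma lens_rel_sym (R : realType) (p q : nat) : symmetric (@lens_rel R p q).
Proof.
move=> x y; apply/asboolP/asboolP => -[k e]; exists (- k);
  by rewrite e lens_actD addNr lens_act0.
Qed.

Lemma lens_rel_trans (R : realType) (p q : nat) : transitive (@lens_rel R p q).
Proof.
move=> y x z /asboolP[k e] /asboolP[l f]; apply/asboolP; exists (l + k).
by rewrite f e lens_actD.
Qed.

Canonical lens_equiv (R : realType) (p q : nat) : equiv_rel (sphere3 R) :=
  EquivRel (@lens_rel R p q) (@lens_rel_refl R p q) (@lens_rel_sym R p q)
    (@lens_rel_trans R p q).

Definition lens_space (R : realType) (p q : nat) : topologicalType :=
  quotient_topology {eq_quot (lens_equiv R p q)}%qT.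

Definition lens_proj (R : realType) (p q : nat) (x : sphere3 R) :
  lens_space R p q := \pi_({eq_quot (lens_equiv R p q)})%qT x.

(* The maximal atlas for which S^3 -> L(p,q) is a local diffeomorphism: near
   each point x above [cdom c], [cfun c \o lens_proj] is smooth on S^3, i.e.
   locally the restriction of a smooth map on an open subset of R^4, and
   [cinv c] lifts to a smooth map into S^3 through x. *)
Definition lens_atlas (R : realType) (p q : nat) :
    set (chart R (lens_space R p q) 3) :=
  [set c | homeo_chart c /\
    forall x : sphere3 R, cdom c (lens_proj p q x) ->
      (exists (U : set 'rV[R]_4) (F : 'rV[R]_4 -> 'rV[R]_3),
         [/\ open U, U (\val x), smooth_on U F &
             forall z : sphere3 R, U (\val z) ->
               cfun c (lens_proj p q z) = F (\val z)]) /\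
      (exists (V : set 'rV[R]_3) (s : 'rV[R]_3 -> sphere3 R),
         [/\ open V, V (cfun c (lens_proj p q x)),
             smooth_on V (fun y => \val (s y)),
             s (cfun c (lens_proj p q x)) = x &
             forall y, V y -> lens_proj p q (s y) = cinv c y])].
Arguments lens_atlas R p q : clear implicits.

(* Main.v *)
(* The contact form is that of an irrational ellipsoid.  On S^3 put
     alpha_z(U) = (x_1 U_(y_1) - y_1 U_(x_1)) + mu^-1 (x_2 U_(y_2) - y_2 U_(x_2))
   with mu = sqrt 2.  Its Reeb field is (i z_1, i mu z_2), with flow
   diag (e^(i t), e^(i mu t)); both are invariant under the deck group, so they
   descend to L(p,q).  A closed orbit through z lifts to a flow line whose end
   point is a deck translate of z; as mu is irrational this forces z_1 = 0 or
   z_2 = 0, which gives exactly two simple orbits.  Along such an orbit the return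
   map on the contact plane is, after a deck translation, a rotation by an angle
   that irrationality keeps away from 2 pi Z.  Each simple orbit lifts to an arc
   that is not closed, hence is not contractible. *)
Require Import Defs.
From mathcomp Require Import all_boot all_order all_algebra.
From HB Require Import structures.
From mathcomp Require Import generic_quotient.
From mathcomp Require Import all_classical all_reals all_analysis.
From mathcomp Require Import ring lra.

Set Implicit Arguments.
Unset Strict Implicit.
Unset Printing Implicit Defensive.

Import Order.TTheory GRing.Theory Num.Theory.
Import numFieldNormedType.Exports.

Local Open Scope classical_set_scope.
Local Open Scope ring_scope.

(** * Smooth functions *)

(** The statement speaks through the charts of a maximal atlas on a quotient, where no formula can
    be differentiated directly. Every computation is therefore moved to smooth maps from open sets
    of R^3 into R^4, the local lifts of [cinv c]; two such lifts differ locally by one deck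
    rotation, which is linear and preserves the form. Three standard theories are replaced by
    explicit arguments. Uniqueness of Reeb curves: rotating a lifted curve back by the linear flow
    leaves a curve with zero derivative. Covering spaces: a uniform lower bound [rho] on the
    displacement of nontrivial deck transformations yields both local uniqueness of lifts and the
    monodromy argument. Return map: the flow followed by a deck rotation fixes the chosen lift and
    is linear on R^4, so an eigenvector downstairs becomes a fixed vector of a pair of plane
    rotations. The number sqrt 2 enters only through its positivity and irrationality. *)

Section Locality.
Context {R : realType} {V W : normedModType R}.
Implicit Types (f g : V -> W) (x v : V).

(** Locality of differentiability reduces to this case, since [g] is [f] plus the function [g - f],
    which vanishes near the point. *)
Lemma near0_is_diff f x : (\near x, f x = 0) -> is_diff x f (\0 : V -> W).
Proof.
move=> f0.
have E : f \o shift x = cst (f x) + (\0 : V -> W) +o_ 0 id.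
  apply/eqaddoP => _/posnumP[e].
  have f0' := nbhs_singleton f0.
  near=> y => /=.
  rewrite -![(_ + _ : _ -> _) _]/(_ + _) -![(- _ : _ -> _) _]/(- _) /= f0'.
  rewrite (_ : f (y + x) = 0); first by rewrite addr0 subr0 normr0 mulr_ge0.
  near: y; move: f0; rewrite (near_shift 0).
  by apply: filterS => y /=; rewrite subr0.
have D : 'd f x = (\0 : V -> W) :> (V -> W).
  by apply: diff_unique => //; exact: cst_continuous.
by split=> //; apply/diff_locallyP; rewrite D; split=> //; exact: cst_continuous.
Unshelve. all: by end_near. Qed.

Lemma near_eq_differentiable f g x : (\near x, f x = g x) ->
  differentiable f x -> differentiable g x.
Proof.
move=> fg df; have -> : g = f + (g - f).
  by apply/funext => y; rewrite !fctE addrC subrK.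
have [//|] := @near0_is_diff (g - f) x; last by move=> dgf _; exact: differentiableD.
by apply: filterS fg => y; rewrite !fctE => ->; rewrite subrr.
Qed.

Lemma near_eq_diff f g x : (\near x, f x = g x) ->
  differentiable f x -> 'd g x = 'd f x :> (V -> W).
Proof.
move=> fg df; apply/funext => v; rewrite -!deriveE //.
  by rewrite (near_eq_derive _ fg).
exact: near_eq_differentiable df.
Qed.

End Locality.

Section Smooth.
Context {R : realType} {V W : normedModType R}.
Implicit Types (f g : V -> W) (x v : V) (U : set V).

Lemma eq_on_iter_derive U f g vs : open U -> {in U, f =1 g} ->
  {in U, foldr (fun v h => 'D_v h) f vs =1 foldr (fun v h => 'D_v h) g vs}.
Proof.
move=> oU fg; elim: vs => //= v vs IH x /set_mem Ux.
apply: near_eq_derive; have := open_nbhs_nbhs (conj oU Ux).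
by apply: filterS => y Uy; apply: IH; exact: mem_set.
Qed.

(* Coinduction: a class of differentiable functions that is stable under
   directional derivatives consists of smooth functions. *)
Lemma smooth_on_coind U (P : set (V -> W)) : open U ->
  (forall f, P f -> (forall x, U x -> differentiable f x) /\
     forall v, exists2 g, P g & {in U, 'D_v f =1 g}) ->
  forall f, P f -> smooth_on U f.
Proof.
(* [foldr] differentiates along the last vector of the list first, so peeling off that vector
   replaces [f] by another member of [P]. *)
move=> oU HP f Pf vs; elim/last_ind: vs f Pf => [|vs v IH] f Pf x Ux.
  by have [df _] := HP f Pf; exact: df.
have [_ /(_ v)[g Pg fg]] := HP f Pf; rewrite foldr_rcons.
apply: near_eq_differentiable (IH g Pg x Ux).
have := open_nbhs_nbhs (conj oU Ux); apply: filterS => y Uy.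
by apply/esym; apply: (eq_on_iter_derive (U := U)) => //; exact: mem_set.
Qed.

Lemma smooth_on_differentiable U f x : smooth_on U f -> U x ->
  differentiable f x.
Proof. by move=> sf; exact: (sf [::]). Qed.

Lemma smooth_on_derive U f v : smooth_on U f -> smooth_on U ('D_v f).
Proof. by move=> sf vs x Ux; have := sf (rcons vs v) x Ux; rewrite foldr_rcons. Qed.

Lemma sub_smooth_on U U' f : U `<=` U' -> smooth_on U' f -> smooth_on U f.
Proof. by move=> UU' sf vs x /UU'; exact: sf. Qed.

Lemma eq_smooth_on U f g : open U -> {in U, f =1 g} ->
  smooth_on U f -> smooth_on U g.
Proof.
move=> oU fg sf vs x Ux; apply: near_eq_differentiable (sf vs x Ux).
have := open_nbhs_nbhs (conj oU Ux); apply: filterS => y Uy.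
by apply: (eq_on_iter_derive (U := U)) => //; exact: mem_set.
Qed.

Lemma linear_smooth_on U (f : {linear V -> W}) : open U -> continuous f ->
  smooth_on U f.
Proof.
move=> oU cf.
apply: (smooth_on_coind (P := [set g : V -> W | g = f \/ exists a, g = cst a])) => //.
  move=> _ /= [->|[a ->]]; (split=> [x Ux|v]); last first.
  - by exists (cst 0) => [|x _]; [by right; exists 0 | rewrite derive_cst].
  - by [].
  - exists (cst (f v)) => [|x _]; first by right; exists (f v).
    by rewrite deriveE ?diff_lin //; exact: linear_differentiable.
  - exact: linear_differentiable.
by left.
Qed.

Lemma cst_smooth_on U (a : W) : open U -> smooth_on U (cst a).
Proof.
move=> oU; apply: (smooth_on_coind (P := [set g : V -> W | exists a, g = cst a])) => //.
  move=> _ /= [b ->]; split=> [x Ux|v]; first by [].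
  by exists (cst 0) => [|x _]; [by exists 0 | rewrite derive_cst].
by exists a.
Qed.

End Smooth.

Section SmoothScalar.
Context {R : realType} {V : normedModType R}.
Implicit Types (f g : V -> R) (x v : V) (U : set V).

(** Sums, products and inverses are closed under derivation only jointly, because the derivative of
    an inverse is a product with inverses. This generated algebra is the class to which the
    coinduction applies. *)
Inductive smooth_algebra U : set (V -> R) :=
| SmoothAtom f of smooth_on U f : smooth_algebra U f
| SmoothAdd f g of smooth_algebra U f & smooth_algebra U g :
    smooth_algebra U (f \+ g)
| SmoothMul f g of smooth_algebra U f & smooth_algebra U g :
    smooth_algebra U (f \* g)
| SmoothInv f of smooth_algebra U f & {in U, forall x, f x != 0} :
    smooth_algebra U (fun x => (f x)^-1).

Lemma smooth_algebraN U f : open U -> smooth_algebra U f ->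
  smooth_algebra U (fun x => - f x).
Proof.
move=> oU sf; have -> : (fun x => - f x) = cst (-1) \* f.
  by apply/funext => x /=; rewrite mulN1r.
by apply: SmoothMul => //; apply: SmoothAtom; exact: cst_smooth_on.
Qed.

Lemma smooth_algebra_differentiable U f : open U -> smooth_algebra U f ->
  forall x, U x -> differentiable f x.
Proof.
move=> oU; elim=> {f}.
- by move=> f sf x; exact: smooth_on_differentiable.
- by move=> f g _ df _ dg x Ux; apply: differentiableD; [exact: df|exact: dg].
- by move=> f g _ df _ dg x Ux; apply: differentiableM; [exact: df|exact: dg].
- move=> f _ df f0 x Ux; apply: differentiableV; first exact: df.
  by apply: f0; rewrite inE.
Qed.

Lemma smooth_algebra_smooth U f : open U -> smooth_algebra U f ->
  smooth_on U f.
Proof.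
move=> oU; move: f; apply: smooth_on_coind => // f sf.
split; first exact: smooth_algebra_differentiable.
elim: sf => {f}.
- move=> f sf v; exists ('D_v f) => //; apply: SmoothAtom.
  exact: smooth_on_derive.
- move=> f g sf IHf sg IHg v.
  have [f' sf' ff'] := IHf v; have [g' sg' gg'] := IHg v.
  exists (f' \+ g'); first exact: SmoothAdd.
  move=> x /[dup] Ux /set_mem Ux' /=; rewrite -ff' // -gg' //.
  by apply: (deriveD (f := f) (g := g)); apply: diff_derivable;
    apply: smooth_algebra_differentiable Ux'.
- move=> f g sf IHf sg IHg v.
  have [f' sf' ff'] := IHf v; have [g' sg' gg'] := IHg v.
  exists ((f \* g') \+ (g \* f')).
    by apply: SmoothAdd; apply: SmoothMul.
  move=> x /[dup] Ux /set_mem Ux' /=; rewrite -ff' // -gg' //.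
  by apply: (deriveM (f := f) (g := g)); apply: diff_derivable;
    apply: smooth_algebra_differentiable Ux'.
- move=> f sf IHf f0 v; have [f' sf' ff'] := IHf v.
  have sfV : smooth_algebra U (fun x => (f x)^-1) by exact: SmoothInv.
  exists ((fun x => - f' x) \* ((fun x => (f x)^-1) \* (fun x => (f x)^-1))).
    by apply: SmoothMul; [exact: smooth_algebraN|exact: SmoothMul].
  move=> x /[dup] Ux /set_mem Ux' /=; rewrite -ff' //.
  rewrite (deriveV (f := f)) ?f0 //; last first.
    by apply: diff_derivable; apply: smooth_algebra_differentiable Ux'.
  by rewrite /GRing.scale /= expr2 invfM; ring.
Qed.

Lemma smooth_onD U f g : open U -> smooth_on U f -> smooth_on U g ->
  smooth_on U (fun x => f x + g x).
Proof.
move=> oU sf sg; apply: smooth_algebra_smooth => //.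
by apply: (SmoothAdd (f := f) (g := g)); exact: SmoothAtom.
Qed.

Lemma smooth_onM U f g : open U -> smooth_on U f -> smooth_on U g ->
  smooth_on U (fun x => f x * g x).
Proof.
move=> oU sf sg; apply: smooth_algebra_smooth => //.
by apply: (SmoothMul (f := f) (g := g)); exact: SmoothAtom.
Qed.

Lemma smooth_onN U f : open U -> smooth_on U f -> smooth_on U (fun x => - f x).
Proof.
move=> oU sf; apply: smooth_algebra_smooth => //; apply: smooth_algebraN => //.
exact: SmoothAtom.
Qed.

Lemma smooth_onV U f : open U -> smooth_on U f -> {in U, forall x, f x != 0} ->
  smooth_on U (fun x => (f x)^-1).
Proof.
move=> oU sf f0; apply: smooth_algebra_smooth => //.
by apply: SmoothInv => //; exact: SmoothAtom.
Qed.

End SmoothScalar.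

Section SmoothMatrix.
Context {R : realType} {V : normedModType R} {m n : nat}.
Implicit Types (f : V -> 'M[R]_(m, n)) (x v : V) (U : set V).

Lemma differentiable_mx f x :
  (forall i j, differentiable (fun y => f y i j) x) -> differentiable f x.
Proof.
move=> df.
have -> : f = fun y => \sum_i \sum_j f y i j *: delta_mx i j.
  by apply/funext => y; rewrite {1}[f y]matrix_sum_delta.
have -> : (fun y => \sum_i \sum_j f y i j *: delta_mx i j) =
   \sum_i \sum_j (fun y => f y i j *: delta_mx i j : 'M[R]_(m, n)).
  apply/funext => y; rewrite fct_sumE; apply: eq_bigr => i _.
  by rewrite fct_sumE.
apply: differentiable_sum => i; apply: differentiable_sum => j.
exact: differentiableZl.
Qed.

Lemma differentiable_entry f x i j :
  differentiable f x -> differentiable (fun y => f y i j) x.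
Proof.
by move=> df; apply: (differentiable_comp (g := fun M : 'M[R]_(m, n) => M i j)) => //;
  exact: differentiable_coord.
Qed.

Lemma derive_entry f x v i j : differentiable f x ->
  'D_v (fun y => f y i j) x = 'D_v f x i j.
Proof. by move=> df; rewrite derive_mx ?mxE //; exact: diff_derivable. Qed.

Lemma smooth_on_mx U f : open U ->
  (forall i j, smooth_on U (fun y => f y i j)) -> smooth_on U f.
Proof.
move=> oU; move: f.
apply: (smooth_on_coind
  (P := [set f : V -> 'M[R]_(m, n) |
    forall i j, smooth_on U (fun y => f y i j)])) => // f /= sf.
have df x : U x -> differentiable f x.
  by move=> Ux; apply: differentiable_mx => i j;
    exact: smooth_on_differentiable (sf i j) Ux.
split=> // v; exists ('D_v f) => // i j.
apply: eq_smooth_on (smooth_on_derive v (sf i j)) => // x /set_mem Ux.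
by rewrite derive_entry //; exact: df.
Qed.

Lemma smooth_on_entry U f i j : open U -> smooth_on U f ->
  smooth_on U (fun y => f y i j).
Proof.
move=> oU sf.
apply: (smooth_on_coind
  (P := [set h : V -> R | exists f : V -> 'M[R]_(m, n),
    smooth_on U f /\ h = (fun y => f y i j)])) => //;
  last by exists f.
move=> _ [g [sg ->]]; split.
  by move=> x Ux; apply: differentiable_entry; exact: smooth_on_differentiable Ux.
move=> v; exists (fun y => 'D_v g y i j).
  by exists ('D_v g); split=> //; exact: smooth_on_derive.
by move=> x /set_mem Ux; rewrite derive_entry //; exact: smooth_on_differentiable Ux.
Qed.

End SmoothMatrix.

(** Expanding in the standard basis makes differentiability automatic in finite dimension, with no
    continuity assumption on [f]. *)
Lemma rV_linear_differentiable (R : realType) (n : nat) (W : normedModType R)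
  (f : {linear 'rV[R]_n -> W}) x : differentiable f x.
Proof.
have -> : f = (\sum_(i < n) (fun y : 'rV[R]_n => y 0 i *: f (delta_mx 0 i)))
    :> (_ -> _).
  apply/funext => y; rewrite fct_sumE {1}[y]row_sum_delta linear_sum.
  by apply: eq_bigr => i _; rewrite linearZ.
apply: differentiable_sum => i; apply: differentiableZl.
exact: differentiable_coord.
Qed.

Lemma rV_linear_smooth (R : realType) (n : nat) (W : normedModType R)
  (f : {linear 'rV[R]_n -> W}) (U : set 'rV[R]_n) : open U -> smooth_on U f.
Proof.
move=> oU; apply: linear_smooth_on => // x.
by apply: differentiable_continuous; exact: rV_linear_differentiable.
Qed.

Lemma smooth_on_linear_comp (R : realType) (V W : normedModType R) n
    (f : {linear 'rV[R]_n -> W}) (g : V -> 'rV[R]_n) (U : set V) : open U ->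
  smooth_on U g -> smooth_on U (fun x => f (g x)).
Proof.
move=> oU sg; have df := rV_linear_differentiable f.
apply: (smooth_on_coind
  (P := [set h | exists2 g, smooth_on U g & h = (fun x => f (g x))])) => //.
- move=> _ [h sh ->]; have dh x (Ux : U x) := smooth_on_differentiable sh Ux.
  split=> [x Ux|v]; first exact: differentiable_comp (dh x Ux) (df _).
  exists (fun x => f ('D_v h x)).
    by exists ('D_v h) => //; exact: smooth_on_derive.
  move=> x /set_mem Ux.
  rewrite deriveE; last exact: differentiable_comp (dh x Ux) (df _).
  rewrite (diff_comp (dh x Ux) (df _)) /= deriveE; last exact: dh.
  rewrite diff_lin // => y; apply: differentiable_continuous; exact: df.
- by exists g.
Qed.

(** * Symmetry of second derivatives *)

Lemma is_derive_curve_comp (R : realType) (V W : normedModType R) (f : V -> W)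
    (g : R -> V) (t : R) (w : V) :
  is_derive t 1 g w -> differentiable f (g t) ->
  is_derive t 1 (f \o g) ('D_w f (g t)).
Proof.
move=> [dg gw] df.
have dg' : differentiable g t by apply/derivable1_diffP.
have dfg : differentiable (f \o g) t by exact: differentiable_comp.
split; first exact/derivable1_diffP.
have <- : 'd g t 1 = w by rewrite -deriveE.
by rewrite !deriveE // diff_comp.
Qed.

Lemma is_derive_line (R : realType) (V W : normedModType R) (f : V -> W)
    (a u : V) (t : R) : differentiable f (t *: u + a) ->
  is_derive t 1 (fun s => f (s *: u + a)) ('D_u f (t *: u + a)).
Proof.
move=> df; apply: (@is_derive_curve_comp _ _ _ f (fun s => s *: u + a) t u) => //.
have dl : is_diff t (fun s : R => s *: u) (fun s => s *: u) by exact: is_diff_scalel.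
have dl' : is_derive t (1 : R) (fun s : R => s *: u) u.
  by split; [exact/derivable1_diffP|rewrite deriveE // diff_val scale1r].
by have := is_deriveD dl' (is_derive_cst a t 1); rewrite addr0.
Qed.


Lemma diff_nearP (R : realType) (V W : normedModType R) (f : V -> W) (x : V)
    (e : R) : 0 < e -> differentiable f x ->
  \forall h \near 0, `|f (h + x) - f x - 'd f x h| <= e * `|h|.
Proof.
move=> e0 /diff_locally /eqaddoP /(_ _ e0); apply: filterS => h /=.
by rewrite -![(_ + _ : _ -> _) _]/(_ + _) -![(- _ : _ -> _) _]/(- _) /= opprD addrA.
Qed.

Section Schwarz.
Context {R : realType} {V : normedModType R}.

(** The mean value theorem in the direction [u] turns the second difference over a parallelogram
    into a first difference of ['D_u f], which is then expanded at [x]. Differentiability of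
    ['D_u f] at the single point [x] is enough for this. *)
Lemma second_difference (f : V -> R) (x u v : V) (e : R) : 0 < e ->
  (\near x, differentiable f x) -> differentiable ('D_u f) x ->
  \forall t \near 0^'+,
    `|f (t *: u + (t *: v + x)) - f (t *: u + x) - (f (t *: v + x) - f x)
      - t ^+ 2 * 'D_v ('D_u f) x| <= e * t ^+ 2.
Proof.
move=> e0 df dG; set G := 'D_u f.
(* The two expansion errors below are at most [e / M] times [|s u + t v|] and [|s u|], whose sum is
   at most [t * M]; the added 1 keeps [M] positive. *)
pose M := `|u| + (`|u| + `|v|) + 1.
have M0 : 0 < M by rewrite /M; have := normr_ge0 u; have := normr_ge0 v; lra.
have eM : 0 < e / M by rewrite divr_gt0.
have /nbhs_ballP[d1 /= d10 GE] := diff_nearP eM dG.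
have /nbhs_ballP[d2 /= d20 df'] := df.
pose d := Num.min d1 d2 / M.
have d0 : 0 < d by rewrite divr_gt0 // lt_min d10.
near=> t.
have t0 : 0 < t by near: t; exact: nbhs_right_gt.
have td : t < d by near: t; exact: nbhs_right_lt.
have tM : t * M < Num.min d1 d2 by rewrite -ltr_pdivlMr.
have small s b : 0 <= s <= t -> (b = 0 \/ b = t) ->
    `|s *: u + b *: v| <= t * (`|u| + `|v|).
  move=> /andP[s0 st] bE; rewrite (le_trans (ler_normD _ _)) // !normrZ mulrDr.
  have b0 : 0 <= b <= t by case: bE => ->; rewrite lexx ltW.
  case/andP: b0 => b0 bt.
  by rewrite (ger0_norm s0) (ger0_norm b0) lerD // ler_wpM2r.
have uvM : t * (`|u| + `|v|) < t * M.
  by rewrite ltr_pM2l // /M; have := normr_ge0 u; lra.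
have smallM s b : 0 <= s <= t -> (b = 0 \/ b = t) ->
    `|s *: u + b *: v| < Num.min d1 d2.
  by move=> s0 bE; rewrite (le_lt_trans (small s b s0 bE)) // (lt_trans uvM).
have dfs s b : 0 <= s <= t -> (b = 0 \/ b = t) ->
    differentiable f (s *: u + (b *: v + x)).
  move=> s0 bE; apply: df'; rewrite /= -ball_normE /= addrA opprD addrCA subrr.
  rewrite addr0 normrN; have := smallM s b s0 bE; rewrite lt_min.
  by case/andP.
(* The term [0 *: v] gives both summands the shape [s u + b v + x] with [b] equal to 0 or [t], so
   one estimate serves for both. *)
pose phi s := f (s *: u + (t *: v + x)) - f (s *: u + (0 *: v + x)).
pose dphi s := G (s *: u + (t *: v + x)) - G (s *: u + (0 *: v + x)).
have st (s : R) : s \in `]0, t[ -> 0 <= s <= t.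
  by rewrite in_itv /= => /andP[/ltW-> /ltW->].
have dphiE s : 0 <= s <= t -> is_derive s 1 phi (dphi s).
  move=> s0; apply: is_deriveB; apply: is_derive_line; apply: dfs => //;
    by [left|right].
have cphi : {within `[0, t], continuous phi}.
  apply: derivable_within_continuous => s; rewrite in_itv /= => s0.
  by have [] := dphiE s s0.
have [s sI] := MVT t0 (fun s sI => dphiE s (st s sI)) cphi.
rewrite /phi subr0 !scale0r !add0r => ->.
have s0 := st s sI.
have GG b : (b = 0 \/ b = t) ->
    `|G (s *: u + (b *: v + x)) - G x - 'd G x (s *: u + b *: v)| <=
    e / M * `|s *: u + b *: v|.
  move=> bE; rewrite addrA; apply: GE; rewrite -ball_normE /= sub0r normrN.
  by have := smallM s b s0 bE; rewrite lt_min; case/andP.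
have G1 := GG t (or_intror erefl); have G0 := GG 0 (or_introl erefl).
rewrite /dphi -/G deriveE //.
set A := G _ in G1 *; set B := G _ in G0 *.
have -> : (A - B) * t - t ^+ 2 * 'd G x v =
   t * ((A - G x - 'd G x (s *: u + t *: v)) - (B - G x - 'd G x (s *: u + 0 *: v))).
  rewrite scale0r addr0 linearD linearZ /= ['d G x (t *: v)]linearZ /=.
  by rewrite /GRing.scale /=; ring.
rewrite normrM (gtr0_norm t0) expr2 mulrCA ler_pM2l //.
apply: le_trans (ler_normB _ _) _; apply: le_trans (lerD G1 G0) _.
have S1 := small s t s0 (or_intror erefl); have S0 := small s 0 s0 (or_introl erefl).
rewrite -mulrDr mulrAC ler_pdivrMr // -mulrA ler_pM2l //.
move: S1 (normr_ge0 v) (ltW t0); rewrite scale0r addr0 normrZ => S1 v0 t0'.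
have su : `|s| * `|u| <= t * `|u|.
  by apply: ler_wpM2r => //; case/andP: s0 => s0 ?; rewrite ger0_norm.
apply: (le_trans (lerD S1 su)); rewrite /M; lra.
Unshelve. all: by end_near. Qed.

(** The second difference is symmetric in [u] and [v], and divided by [t ^+ 2] it approximates both
    mixed derivatives. *)
Lemma derive_comm (f : V -> R) (x u v : V) :
  (\near x, differentiable f x) -> differentiable ('D_u f) x ->
  differentiable ('D_v f) x -> 'D_v ('D_u f) x = 'D_u ('D_v f) x.
Proof.
move=> df du dv; apply/eqP; rewrite -subr_eq0 -normr_le0; apply/ler_addgt0Pr => e e0.
rewrite add0r; have e2 : 0 < e / 2 by rewrite divr_gt0.
have N1 := @second_difference f x u v _ e2 df du.
have N2 := @second_difference f x v u _ e2 df dv.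
have [t [/= [H1 H2] t0]] := filter_ex (filterI (filterI N1 N2) (nbhs_right_gt (0 : R))).
have t20 : 0 < t ^+ 2 by rewrite exprn_gt0.
rewrite -(ler_pM2r t20) -[X in _ * X](gtr0_norm t20) -normrM.
rewrite [t *: v + (t *: u + x)]addrCA in H2.
move: H1 H2; move: (f (t *: u + _)) (f (t *: u + _)) (f (t *: v + _)) (f x).
move: ('D_v ('D_u f) x) ('D_u ('D_v f) x) (t ^+ 2) => D1 D2 T a b c d.
rewrite !ler_norml => /andP[? ?] /andP[? ?].
by rewrite mulrBl; apply/andP; split; lra.
Qed.

End Schwarz.

(** * Coordinates on C^2 *)

Section Trigonometry.
Context {R : realType}.
Implicit Types (x : R) (m : int).

Lemma cos_sinD2piz x m :
  cos (x + 2 * pi * m%:~R) = cos x /\ sin (x + 2 * pi * m%:~R) = sin x.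
Proof.
have E (n : nat) : 2 * pi * n%:R = (pi *+ 2 : R) *+ n.
  by rewrite mulr_natr mulr_natl.
have C := periodicn (@cosD2pi R); have S := periodicn (@sinD2pi R).
case: m => n; first by rewrite -pmulrn E C S.
rewrite NegzE mulrNz mulrN -pmulrn E.
by split; [rewrite -[LHS](C n.+1)|rewrite -[LHS](S n.+1)]; rewrite subrK.
Qed.

(** Subtracting full turns brings the angle into [0, 2 pi). There [cos] is injective on the lower
    half, and the upper half is reflected by [2 * pi - y]. *)
Lemma cos_eq1 x : cos x = 1 -> exists m : int, x = 2 * pi * m%:~R.
Proof.
have pi0 := pi_gt0 R.
move=> cx; exists (Num.floor (x / (2 * pi))).
set m := Num.floor _; pose y := x - 2 * pi * m%:~R.
have cy : cos y = 1.
  by rewrite -[RHS]cx -[in RHS](subrK (2 * pi * m%:~R) x) (cos_sinD2piz _ _).1.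
have /andP[y0 y2] : 0 <= y < 2 * pi.
  have /andP[h1 h2] := floor_itv (x / (2 * pi)).
  rewrite -/m in h1 h2; rewrite subr_ge0 ltrBlDr.
  rewrite ler_pdivlMr ?mulr_gt0 // in h1; rewrite ltr_pdivrMr ?mulr_gt0 // in h2.
  rewrite mulrC h1 /=; rewrite (lt_le_trans h2) // intrD mulrDl mul1r addrC.
  by rewrite mulrC.
suff : y = 0 by move=> /eqP; rewrite subr_eq0 => /eqP.
have [ypi|ypi] := leP y pi.
  by apply: cos_inj; rewrite ?cos0 // in_itv /= ?y0 ?lexx ?pi_ge0.
have : 2 * pi - y = 0.
  apply: cos_inj; rewrite ?cos0 ?in_itv /= ?lexx ?pi_ge0 //; first lra.
  by have := (cos_sinD2piz (- y) 1).1; rewrite cosN mulr1 cy addrC.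
lra.
Qed.

End Trigonometry.

Section C2.
Context {R : realType}.
Implicit Types (x y : 'rV[R]_4) (s t : R).

Definition crd x (i : nat) : R := x 0 (inord i).

(** The ambient norm on row vectors is the max norm, which rotations do not preserve. Distances on
    the sphere are therefore squared Euclidean ones, and each triangle inequality costs a factor
    2. *)
Definition sqnorm x : R := \sum_(i < 4) x 0 i ^+ 2.

Lemma eq_crd x y : (forall i, (i < 4)%N -> crd x i = crd y i) -> x = y.
Proof.
by move=> xy; apply/rowP => i; have := xy i (ltn_ord i); rewrite /crd inord_val.
Qed.

Lemma eq_crd4 x y : crd x 0 = crd y 0 -> crd x 1 = crd y 1 ->
  crd x 2 = crd y 2 -> crd x 3 = crd y 3 -> x = y.
Proof. by move=> ? ? ? ?; apply: eq_crd; case=> [|[|[|[|]]]]. Qed.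

Lemma sqnormE x :
  sqnorm x = crd x 0 ^+ 2 + crd x 1 ^+ 2 + (crd x 2 ^+ 2 + crd x 3 ^+ 2).
Proof.
rewrite /sqnorm !big_ord_recl big_ord0 addr0 !addrA /crd.
by congr (_ + _ + _ + _); congr (x _ _ ^+ 2); apply/val_inj; rewrite /= inordK.
Qed.

Lemma crdD x y i : crd (x + y) i = crd x i + crd y i.
Proof. by rewrite /crd mxE. Qed.

Lemma crdN x i : crd (- x) i = - crd x i.
Proof. by rewrite /crd mxE. Qed.

Lemma crdZ a x i : crd (a *: x) i = a * crd x i.
Proof. by rewrite /crd mxE. Qed.

Lemma crd0 i : crd 0 i = 0.
Proof. by rewrite /crd mxE. Qed.

Definition row4 (a b c d : R) : 'rV[R]_4 := \row_(j < 4) nth 0 [:: a; b; c; d] j.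

Lemma crd_row4 a b c d i : (i < 4)%N ->
  crd (row4 a b c d) i = nth 0 [:: a; b; c; d] i.
Proof. by move=> i4; rewrite /crd mxE inordK. Qed.

Lemma crd_rot s t x i : (i < 4)%N -> crd (diag_rot s t x) i =
  nth 0 [:: cos s * crd x 0 - sin s * crd x 1;
            sin s * crd x 0 + cos s * crd x 1;
            cos t * crd x 2 - sin t * crd x 3;
            sin t * crd x 2 + cos t * crd x 3] i.
Proof. by move=> i4; rewrite /crd mxE inordK. Qed.

Definition crdE := (crdD, crdN, crdZ, crd0).

Lemma sqnorm_ge0 x : 0 <= sqnorm x.
Proof. by rewrite sumr_ge0 // => i _; exact: sqr_ge0. Qed.

Lemma sqnormD_le x y : sqnorm (x + y) <= 2 * (sqnorm x + sqnorm y).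
Proof.
rewrite -subr_ge0 (_ : _ - _ = sqnorm (x - y)) ?sqnorm_ge0 //.
by rewrite !sqnormE !crdE; ring.
Qed.

Lemma sqnormN x : sqnorm (- x) = sqnorm x.
Proof. by rewrite !sqnormE !crdE !sqrrN. Qed.

Lemma sqnorm_rot s t x : sqnorm (diag_rot s t x) = sqnorm x.
Proof.
rewrite !sqnormE !crd_rot //=.
have := cos2Dsin2 s; have := cos2Dsin2 t => Et Es.
rewrite -[crd x 0 ^+ 2 + _]mul1r -[crd x 2 ^+ 2 + _]mul1r -{1}Es -Et; ring.
Qed.

Lemma rot_linear s t : linear (@diag_rot R s t).
Proof.
move=> a x y; apply: eq_crd4; rewrite !crdE !crd_rot //= !crdE; ring.
Qed.

Lemma rotB s t x y : diag_rot s t (x - y) = diag_rot s t x - diag_rot s t y.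
Proof. by rewrite addrC -scaleN1r rot_linear scaleN1r addrC. Qed.

(** In each complex plane this is |e^(i s) - 1|^2 = 2 - 2 cos s. It yields both the displacement of
    deck transformations and the fixed vectors of a rotation. *)
Lemma sqnorm_rot_sub s t x : sqnorm (diag_rot s t x - x) =
  (2 - 2 * cos s) * (crd x 0 ^+ 2 + crd x 1 ^+ 2) +
  (2 - 2 * cos t) * (crd x 2 ^+ 2 + crd x 3 ^+ 2).
Proof.
rewrite !sqnormE !crdE !crd_rot //=.
have := sin2cos2 s; have := sin2cos2 t => Et Es.
have E c d a b : d ^+ 2 = 1 - c ^+ 2 ->
   (c * a - d * b - a) ^+ 2 + (d * a + c * b - b) ^+ 2 =
   (2 - 2 * c) * (a ^+ 2 + b ^+ 2) :> R.
  move=> dE; transitivity ((c ^+ 2 + d ^+ 2 + 1 - 2 * c) * (a ^+ 2 + b ^+ 2)).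
    ring.
  by rewrite dE; congr (_ * _); ring.
by congr (_ + _); exact: E.
Qed.

HB.instance Definition _ s t :=
  GRing.isLinear.Build R 'rV[R]_4 'rV[R]_4 *:%R (@diag_rot R s t) (rot_linear s t).

Lemma rot_differentiable s t x : differentiable (@diag_rot R s t) x.
Proof. exact: (rV_linear_differentiable (@diag_rot R s t)). Qed.

Lemma rot_continuous s t : continuous (@diag_rot R s t).
Proof. by move=> x; apply: differentiable_continuous; exact: rot_differentiable. Qed.

Lemma sqnorm_continuous : continuous (sqnorm).
Proof.
move=> x; apply: differentiable_continuous.
have -> : sqnorm = \sum_(i < 4) (fun y : 'rV[R]_4 => y 0 i ^+ 2).
  by apply/funext => y; rewrite fct_sumE.
apply: differentiable_sum => i.
have d := differentiable_coord x 0 i.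
exact: (differentiableM d d).
Qed.

End C2.

(** * The covering of the lens space by the sphere *)

Section Sphere.
Context {R : realType}.
Local Notation S3 := (sphere3 R).

Lemma sphereP (x : S3) : sqnorm (\val x) = 1.
Proof. exact: set_mem (valP x). Qed.

Lemma val_continuous : continuous (fun x : S3 => \val x).
Proof. exact: initial_continuous. Qed.

Lemma sphere_continuous (T : topologicalType) (f : T -> S3) (t : T) :
  {for t, continuous (fun u => \val (f u))} -> {for t, continuous f}.
Proof.
move=> fx A [B [[C oC <-] Cx] CA].
move: (fx _ (open_nbhs_nbhs (conj oC Cx))).
apply: (@filterS _ (nbhs t) _ (fun t => C (\val (f t))) (f @^-1` A)) => u Cu; exact: CA.
Qed.

Lemma near_sphere (x : S3) (e : R) : 0 < e ->
  \forall y \near x, sqnorm (\val y - \val x) < e.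
Proof.
move=> e0.
have c : continuous (fun y : S3 => sqnorm (\val y - \val x)).
  move=> y; apply: (@continuous_comp _ _ _ (fun y : S3 => \val y - \val x) sqnorm).
    apply: continuousB; first exact: val_continuous. exact: cst_continuous.
  exact: sqnorm_continuous.
apply: (c x [set r | r < e]); rewrite subrr.
have -> : sqnorm (0 : 'rV[R]_4) = 0 by rewrite sqnormE !crd0 expr0n /= !addr0.
exact: lt_nbhsl.
Qed.

Fact srot_subproof s t (x : S3) : diag_rot s t (\val x) \in S3.
Proof.
by apply/mem_set; rewrite /sphere3 /= -/(sqnorm _) sqnorm_rot; exact: sphereP.
Qed.

Definition srot s t (x : S3) : S3 := exist (fun y => y \in S3) _ (srot_subproof s t x).

Lemma srot_continuous s t : continuous (srot s t).
Proof.
move=> x; apply: sphere_continuous.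
have c : {for x, continuous (diag_rot s t \o (fun y : S3 => \val y))}.
  by apply: continuous_comp; [exact: val_continuous|exact: rot_continuous].
exact: c.
Qed.

Lemma srotD s t s' t' x : srot s t (srot s' t' x) = srot (s + s') (t + t') x.
Proof. by apply/val_inj; rewrite /= diag_rotD. Qed.

Lemma srot0 x : srot 0 0 x = x.
Proof. by apply/val_inj; rewrite /= diag_rot0. Qed.

End Sphere.

Section Lens.
Context {R : realType}.
Variables (p q : nat).
Hypotheses (p_gt0 : (0 < p)%N) (co_pq : coprime p q).
Local Notation S3 := (sphere3 R).
Local Notation L := (lens_space R p q).
Local Notation proj := (@lens_proj R p q).
Local Notation ang1 k := (2 * pi * k%:~R / p%:R : R).
Local Notation ang2 k := (2 * pi * k%:~R * q%:R / p%:R : R).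

Definition deck (k : int) : S3 -> S3 := srot (ang1 k) (ang2 k).

Lemma val_deck k x : \val (deck k x) = lens_act p q k (\val x).
Proof. by []. Qed.

Lemma deckD k l x : deck k (deck l x) = deck (k + l) x.
Proof. by apply/val_inj; rewrite !val_deck lens_actD. Qed.

Lemma deck0 x : deck 0 x = x.
Proof. by apply/val_inj; rewrite !val_deck lens_act0. Qed.

Lemma projP x y : proj x = proj y <-> exists k, y = deck k x.
Proof.
split=> [/eqmodP /asboolP[k e]|[k ->]]; first by exists k; apply/val_inj.
by apply/eqmodP/asboolP; exists k.
Qed.

Lemma proj_deck k x : proj (deck k x) = proj x.
Proof. by apply/esym/projP; exists k. Qed.

Definition lens_repr (m : L) : S3 := repr m.

Lemma lens_reprK m : proj (lens_repr m) = m.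
Proof. exact: reprK. Qed.

Lemma proj_surj (m : L) : exists x, m = proj x.
Proof. by exists (lens_repr m); rewrite lens_reprK. Qed.

Lemma lens_proj_continuous : continuous proj.
Proof. exact: pi_continuous. Qed.

(** The saturation of [A] is the union of its preimages under the deck transformations, each of
    which is open. *)
Lemma lens_proj_open (A : set S3) : open A -> open (proj @` A).
Proof.
move=> oA; rewrite /open /= /quotient_open.
have -> : \pi_(L)%qT @^-1` (proj @` A) = \bigcup_(k in [set: int]) (deck k @^-1` A).
  apply/seteqP; split=> [x /= [y Ay]|x [k _ /= Ax]].
    by move/esym/projP => [k yE]; exists k => //=; rewrite -yE.
  by exists (deck k x) => //; exact: proj_deck.
by apply: bigcup_open => k _; apply: open_comp => // x _; exact: srot_continuous.
Qed.

Lemma deck_id k : (p%:Z %| k)%Z -> deck k = id.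
Proof.
move=> /dvdzP[m ->]; apply/funext => x; apply/val_inj.
have p0 : p%:R != 0 :> R by rewrite pnatr_eq0 -lt0n.
have E1 : ang1 (m * p%:Z) = 0 + 2 * pi * m%:~R.
  by rewrite intrM -pmulrn; field.
have E2 : ang2 (m * p%:Z) = 0 + 2 * pi * (m * q%:Z)%:~R.
  by rewrite !intrM -!pmulrn; field.
apply: eq_crd4; rewrite val_deck /lens_act crd_rot //= ?E1 ?E2;
  rewrite !(cos_sinD2piz _ _).1 !(cos_sinD2piz _ _).2 cos0 sin0; ring.
Qed.

Lemma cos_ang1_eq1 k : cos (ang1 k) = 1 -> (p%:Z %| k)%Z.
Proof.
have p0 : p%:R != 0 :> R by rewrite pnatr_eq0 -lt0n.
have pi0 : pi != 0 :> R by rewrite gt_eqF ?pi_gt0.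
move=> /cos_eq1[m mE]; apply/dvdzP; exists m.
apply: (intr_inj (R := R)); rewrite intrM -pmulrn.
have : 2 * pi * (k%:~R / p%:R) = 2 * pi * m%:~R :> R by rewrite -mE; ring.
by move/(mulfI _) => <-; [rewrite divfK|rewrite mulf_neq0 // pnatr_eq0].
Qed.

(** Coprimality cancels [q] in [k * q]; this is what makes the deck group act freely on the circle
    z_1 = 0. *)
Lemma cos_ang2_eq1 k : cos (ang2 k) = 1 -> (p%:Z %| k)%Z.
Proof.
move=> c; rewrite -(@Gauss_dvdzl _ _ q%:Z) //.
by apply: cos_ang1_eq1; rewrite intrM -pmulrn mulrA.
Qed.

Lemma deck_modz k : deck k = deck (k %% p%:Z)%Z.
Proof.
apply/funext => x; rewrite {1}(divz_eq k p%:Z) -deckD.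
by rewrite [deck (_ * _)]deck_id // dvdz_mull.
Qed.

(** On the unit sphere the displacement is a convex combination of 2 - 2 cos over the two rotation
    angles, hence at least the smaller one. Both are positive for a nontrivial [k], and [k] matters
    only modulo [p], so finitely many values are compared. *)
Lemma deck_gap : exists2 rho : R, 0 < rho & forall k,
  deck k = id \/ forall x, rho <= sqnorm (\val (deck k x) - \val x).
Proof.
have finite_gap (c : nat -> R) n : exists2 rho : R, 0 < rho &
    forall k, (k < n)%N -> c k <= 0 \/ rho <= c k.
  elim: n => [|n [r r0 IH]]; first by exists 1.
  have [cn|cn] := leP (c n) 0.
    exists r => // k; rewrite ltnS leq_eqVlt => /orP[/eqP->|]; [by left|exact: IH].
  exists (Num.min r (c n)); first by rewrite lt_min r0.
  move=> k; rewrite ltnS leq_eqVlt => /orP[/eqP->|/IH].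
    by right; rewrite ge_min lexx orbT.
  by case=> [|rc]; [left|right; rewrite ge_min rc].
have [r1 r10 H1] := finite_gap (fun k => 2 - 2 * cos (ang1 k%:Z)) p.
have [r2 r20 H2] := finite_gap (fun k => 2 - 2 * cos (ang2 k%:Z)) p.
exists (Num.min r1 r2); first by rewrite lt_min r10.
move=> k; rewrite deck_modz.
have p0 : p%:Z != 0 by rewrite eqz_nat -lt0n.
have := modz_ge0 k p0; have := ltz_pmod k (d := p%:Z) p_gt0.
case: (k %% p%:Z)%Z => // n np _; have {np}np : (n < p)%N by [].
have cos1 (x : R) : 2 - 2 * cos x <= 0 -> cos x = 1.
  by move=> h; apply/eqP; rewrite eq_le cos_le1 /=; lra.
have [/cos1/cos_ang1_eq1/deck_id|h1] := H1 n np; first by left.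
have [/cos1/cos_ang2_eq1/deck_id|h2] := H2 n np; first by left.
right=> x; rewrite val_deck sqnorm_rot_sub.
have m1 : Num.min r1 r2 <= 2 - 2 * cos (ang1 n%:Z) by rewrite ge_min h1.
have m2 : Num.min r1 r2 <= 2 - 2 * cos (ang2 n%:Z) by rewrite ge_min h2 orbT.
rewrite -[leLHS]mulr1 -[X in _ * X](sphereP x) sqnormE mulrDr.
by apply: lerD; apply: ler_wpM2r => //; rewrite addr_ge0 ?sqr_ge0.
Qed.

Lemma deck_free k x : deck k x = x -> deck k = id.
Proof.
move=> kx; have [rho r0 /(_ k)[//|/(_ x)]] := deck_gap.
rewrite kx subrr (_ : sqnorm _ = 0); first by rewrite leNgt r0.
by rewrite sqnormE !crd0 expr0n /= !addr0.
Qed.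

(** Quantitative form of the covering property, with one [rho] for the whole sphere. *)
Lemma proj_gap : exists2 rho : R, 0 < rho & forall x y,
  proj x = proj y -> sqnorm (\val x - \val y) < rho -> x = y.
Proof.
have [rho r0 H] := deck_gap; exists rho => // x y /esym/projP[k ->].
by case: (H k) => [->|/(_ y)] //; rewrite leNgt => /negbTE ->.
Qed.

(* Two lifts that agree at [t] stay within the gap of each other near [t]. *)
Lemma lift_unique (T : topologicalType) (f g : T -> S3) (t : T) :
  {for t, continuous f} -> {for t, continuous g} -> f t = g t ->
  (\forall u \near t, proj (f u) = proj (g u)) -> \forall u \near t, f u = g u.
Proof.
move=> cf cg fg pfg; have [rho r0 gap] := proj_gap.
(* Two squared distances below [rho / 4], summed and doubled by [sqnormD_le], stay below [rho]. *)
have r4 : 0 < rho / 4 by rewrite divr_gt0.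
have nf := cf _ (near_sphere (f t) r4).
have ng := cg _ (near_sphere (g t) r4).
near=> u; apply: gap; first by near: u.
have fu : sqnorm (\val (f u) - \val (f t)) < rho / 4 by near: u.
have gu : sqnorm (\val (g u) - \val (g t)) < rho / 4 by near: u.
rewrite -fg in gu; rewrite -(subrKA (\val (f t))).
apply: le_lt_trans (sqnormD_le _ _) _.
by rewrite -[sqnorm (_ - \val (g u))]sqnormN opprB; lra.
Unshelve. all: by end_near. Qed.

Lemma lift_unique_deck (T : topologicalType) (f g : T -> S3) (t : T) :
  {for t, continuous f} -> {for t, continuous g} ->
  (\forall u \near t, proj (f u) = proj (g u)) ->
  exists k, \forall u \near t, g u = deck k (f u).
Proof.
move=> cf cg pfg; have /projP[k gE] := nbhs_singleton pfg.
exists k.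
suff : \forall u \near t, deck k (f u) = g u by apply: filterS => u ->.
apply: lift_unique => //.
  exact: (@continuous_comp _ _ _ f (deck k) t cf (@srot_continuous _ _ _ _)).
by apply: filterS pfg => u <-; exact: proj_deck.
Qed.

End Lens.

(** * The contact form upstairs *)

Section ContactAlgebra.
Context {R : realType}.
Variable mu : R.
Hypothesis mu_gt0 : 0 < mu.
Implicit Types z u v : 'rV[R]_4.

Definition dot z u : R := crd z 0 * crd u 0 + crd z 1 * crd u 1 +
  (crd z 2 * crd u 2 + crd z 3 * crd u 3).

(** It plays two parts: with the base point [z] as first argument it is the contact form, and on two
    tangent vectors it is half the exterior derivative, since the contact form depends linearly on
    the base point. *)
Definition symp z u : R := crd z 0 * crd u 1 - crd z 1 * crd u 0 +
  mu^-1 * (crd z 2 * crd u 3 - crd z 3 * crd u 2).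

Definition reeb z : 'rV[R]_4 :=
  row4 (- crd z 1) (crd z 0) (- (mu * crd z 3)) (mu * crd z 2).

Lemma sympDl z z' u a : symp (a *: z + z') u = a * symp z u + symp z' u.
Proof. by rewrite /symp !crdE; ring. Qed.

Lemma sympDr z u u' a : symp z (a *: u + u') = a * symp z u + symp z u'.
Proof. by rewrite /symp !crdE; ring. Qed.

Lemma symp_antisym z u : symp z u = - symp u z.
Proof. by rewrite /symp; ring. Qed.

Lemma symp_rot s t z u : symp (diag_rot s t z) (diag_rot s t u) = symp z u.
Proof.
rewrite /symp !crd_rot //=.
have := sin2cos2 s; have := sin2cos2 t => Et Es.
transitivity ((cos s ^+ 2 + sin s ^+ 2) * (crd z 0 * crd u 1 - crd z 1 * crd u 0) +
  mu^-1 * ((cos t ^+ 2 + sin t ^+ 2) * (crd z 2 * crd u 3 - crd z 3 * crd u 2))).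
  ring.
by rewrite !cos2Dsin2; ring.
Qed.

Lemma symp_reeb_diag z : symp z (reeb z) = sqnorm z.
Proof. by rewrite /symp /reeb sqnormE !crd_row4 //=; field; rewrite gt_eqF. Qed.

Lemma symp_reebl z u : symp (reeb z) u = - dot z u.
Proof. by rewrite /symp /dot /reeb !crd_row4 //=; field; rewrite gt_eqF. Qed.

Lemma dot_reeb z : dot z (reeb z) = 0.
Proof. by rewrite /dot /reeb !crd_row4 //=; ring. Qed.

(** On the pair chosen here the value is |z_2|^2 + mu^-1 |z_1|^2. Together with the Reeb direction
    the pair will show that the contact volume does not vanish. *)
Lemma symp_tangent_neq0 z : sqnorm z = 1 ->
  exists u v, [/\ dot z u = 0, dot z v = 0 & symp u v != 0].
Proof.
move=> z1.
(* The quaternion multiples j z and k z. *)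
exists (row4 (- crd z 2) (crd z 3) (crd z 0) (- crd z 1)).
exists (row4 (- crd z 3) (- crd z 2) (crd z 1) (crd z 0)).
split; rewrite /dot /symp !crd_row4 //=; try ring.
rewrite (_ : _ + _ = crd z 2 ^+ 2 + crd z 3 ^+ 2 +
  mu^-1 * (crd z 0 ^+ 2 + crd z 1 ^+ 2)); last ring.
set a := crd z 0 ^+ 2 + _; set b := crd z 2 ^+ 2 + _.
have a0 : 0 <= a by rewrite addr_ge0 ?sqr_ge0.
have b0 : 0 <= b by rewrite addr_ge0 ?sqr_ge0.
move: z1; rewrite sqnormE -/a -/b => ab.
have m0 : 0 < mu^-1 by rewrite invr_gt0.
have [a00|a00] := eqVneq a 0; first by rewrite a00 mulr0 addr0 gt_eqF //; lra.
by rewrite gt_eqF // ltr_wpDl // mulr_gt0 // lt_neqAle eq_sym a00.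
Qed.

Lemma derive_symp (V : normedModType R) (f g : V -> 'rV[R]_4) (y u : V) :
  differentiable f y -> differentiable g y ->
  'D_u (fun x => symp (f x) (g x)) y =
  symp ('D_u f y) (g y) + symp (f y) ('D_u g y).
Proof.
move=> df dg.
have D (h : V -> 'rV[R]_4) i : differentiable h y ->
    is_derive y u (fun x => crd (h x) i) (crd ('D_u h y) i).
  move=> dh; split; first exact/diff_derivable/differentiable_entry.
  by rewrite /crd derive_entry.
have M i j := is_deriveM (D f i df) (D g j dg).
have [_ E] := is_deriveD (is_deriveB (M 0 1) (M 1 0))
  (is_deriveZ mu^-1 (is_deriveB (M 2 3) (M 3 2))).
rewrite [LHS]E /symp /GRing.scale /=.
move: (crd (f y)) (crd (g y)) (crd ('D_u f y)) (crd ('D_u g y)) => a b a' b'.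
by move: (a 0%N) (a 1%N) (a 2%N) (a 3%N) (b 0%N) (b 1%N) (b 2%N) (b 3%N)
  (a' 0%N) (a' 1%N) (a' 2%N) (a' 3%N) (b' 0%N) (b' 1%N) (b' 2%N) (b' 3%N) => *; ring.
Qed.

Lemma derive_dot (V : normedModType R) (f : V -> 'rV[R]_4) (y u : V) :
  differentiable f y ->
  'D_u (fun x => sqnorm (f x)) y = 2 * dot (f y) ('D_u f y).
Proof.
move=> df.
have D i : is_derive y u (fun x => crd (f x) i) (crd ('D_u f y) i).
  split; first exact/diff_derivable/differentiable_entry.
  by rewrite /crd derive_entry.
have M i := is_deriveM (D i) (D i).
have [_ E] := is_deriveD (is_deriveD (M 0) (M 1)) (is_deriveD (M 2) (M 3)).
have -> : (fun x => sqnorm (f x)) = (fun x => crd (f x) 0) * (fun x => crd (f x) 0) +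
  (fun x => crd (f x) 1) * (fun x => crd (f x) 1) +
  ((fun x => crd (f x) 2) * (fun x => crd (f x) 2) +
  (fun x => crd (f x) 3) * (fun x => crd (f x) 3)).
  by apply/funext => x; rewrite sqnormE.
by rewrite [LHS]E /dot /GRing.scale /=; ring.
Qed.

Lemma dot_mulmx z u : u *m z^T = (dot z u)%:M.
Proof.
apply/matrixP => i j; rewrite !ord1 !mxE eqxx mulr1n.
rewrite !big_ord_recl big_ord0 addr0 !addrA /dot /crd !addrA.
congr (_ + _ + _ + _); rewrite !mxE mulrC;
  by congr (z _ _ * u _ _); apply/val_inj; rewrite /= inordK.
Qed.

End ContactAlgebra.

(** * Alternating forms on R^3 *)

Section R3.
Context {R : realType}.
Implicit Types u v w : 'rV[R]_3.

Definition e3 (i : nat) : 'rV[R]_3 := delta_mx 0 (inord i).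
Definition crd3 u (i : nat) : R := u 0 (inord i).

Lemma rV3_sum u : u = crd3 u 0 *: e3 0 + (crd3 u 1 *: e3 1 + crd3 u 2 *: e3 2).
Proof.
rewrite {1}[u]row_sum_delta !big_ord_recl big_ord0 addr0.
have E i k : (k < 3)%N -> val i = k -> u 0 i *: delta_mx 0 i = crd3 u k *: e3 k.
  by move=> k3 ik; rewrite /crd3 /e3 (_ : inord k = i) //; apply/val_inj;
    rewrite /= inordK.
by congr (_ + (_ + _)); apply: E.
Qed.

(** A 3-form on R^3 is the determinant times its value on the standard basis. The contact volume can
    thus be tested on any convenient triple of vectors. *)
Lemma alternating_triple (al : 'rV[R]_3 -> R) (be : 'rV[R]_3 -> 'rV[R]_3 -> R) :
  (forall a u v, al (a *: u + v) = a * al u + al v) ->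
  (forall a u v w, be (a *: u + v) w = a * be u w + be v w) ->
  (forall u v, be u v = - be v u) ->
  forall u v w, al u * be v w + al v * be w u + al w * be u v =
  (crd3 u 0 * (crd3 v 1 * crd3 w 2 - crd3 v 2 * crd3 w 1) +
   crd3 u 1 * (crd3 v 2 * crd3 w 0 - crd3 v 0 * crd3 w 2) +
   crd3 u 2 * (crd3 v 0 * crd3 w 1 - crd3 v 1 * crd3 w 0)) *
  (al (e3 0) * be (e3 1) (e3 2) + al (e3 1) * be (e3 2) (e3 0) +
   al (e3 2) * be (e3 0) (e3 1)).
Proof.
move=> alL beL beA.
have al0 : al 0 = 0 by have := alL (-1) 0 0; rewrite scaler0 addr0; lra.
have be0 w : be 0 w = 0 by have := beL (-1) 0 0 w; rewrite scaler0 addr0; lra.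
have alE u :
    al u = crd3 u 0 * al (e3 0) + (crd3 u 1 * al (e3 1) + crd3 u 2 * al (e3 2)).
  by rewrite {1}[u]rV3_sum -[crd3 u 2 *: _]addr0 !alL al0 addr0.
have beE u w : be u w =
    crd3 u 0 * be (e3 0) w + (crd3 u 1 * be (e3 1) w + crd3 u 2 * be (e3 2) w).
  by rewrite {1}[u]rV3_sum -[crd3 u 2 *: _]addr0 !beL be0 addr0.
have bee w : be w w = 0 by have := beA w w; lra.
have be2 u w : be u w =
  (crd3 u 1 * crd3 w 2 - crd3 u 2 * crd3 w 1) * be (e3 1) (e3 2) +
  (crd3 u 2 * crd3 w 0 - crd3 u 0 * crd3 w 2) * be (e3 2) (e3 0) +
  (crd3 u 0 * crd3 w 1 - crd3 u 1 * crd3 w 0) * be (e3 0) (e3 1).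
  rewrite beE !(beA (e3 _) w) !(beE w).
  rewrite (beA (e3 2) (e3 1)) (beA (e3 1) (e3 0)) (beA (e3 0) (e3 2)) !bee; ring.
move=> u v w; rewrite (be2 v w) (be2 w u) (be2 u v) (alE u) (alE v) (alE w).
move: (al (e3 0)) (al (e3 1)) (al (e3 2)) (be (e3 1) (e3 2)) (be (e3 2) (e3 0))
  (be (e3 0) (e3 1)) => a0 a1 a2 b0 b1 b2.
move: (crd3 u 0) (crd3 u 1) (crd3 u 2) (crd3 v 0) (crd3 v 1) (crd3 v 2)
  (crd3 w 0) (crd3 w 1) (crd3 w 2) => u0 u1 u2 v0 v1 v2 w0 w1 w2; ring.
Qed.

End R3.

(** * Local sections of the covering *)

Section LocalSections.
Context {R : realType}.
Variables (p q : nat).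
Hypotheses (p_gt0 : (0 < p)%N) (co_pq : coprime p q).
Local Notation S3 := (sphere3 R).
Local Notation L := (lens_space R p q).
Local Notation proj := (@lens_proj R p q).
Local Notation atlas := (lens_atlas R p q).
Implicit Types (c d : chart R L 3) (y v w : 'rV[R]_3).

Lemma cinv_dom c y : atlas c -> cimg c y -> cdom c (cinv c y) /\ cfun c (cinv c y) = y.
Proof. by move=> [[_ _ cK _ _] _] [m cm <-]; rewrite cK. Qed.

Lemma near_cdom c m : atlas c -> cdom c m -> \forall z \near m, cdom c z.
Proof. by move=> [[oc _ _ _ _] _] cy; exact: open_nbhs_nbhs. Qed.

(** A lift of [cinv c] to the sphere: this is the form in which a chart can be differentiated as a
    map into R^4. *)
Definition local_section c (V : set 'rV[R]_3) (s : 'rV[R]_3 -> S3) :=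
  [/\ open V, V `<=` cimg c, smooth_on V (fun y => \val (s y)) &
      forall y, V y -> proj (s y) = cinv c y].

Lemma local_section_exists c (x : S3) : atlas c -> cdom c (proj x) ->
  exists V s, [/\ local_section c V s, V (cfun c (proj x)) &
    s (cfun c (proj x)) = x].
Proof.
move=> Ac cx; have [[_ oi _ _ _] /(_ x cx)[_ [V [s [oV Vx ss sx ps]]]]] := Ac.
exists (V `&` cimg c), s; split=> //; last by split=> //; exists (proj x).
split; [exact: openI|by move=> ? []|exact: sub_smooth_on ss|].
by move=> y [/ps].
Qed.

Lemma local_section_at c y : atlas c -> cimg c y ->
  exists V s, local_section c V s /\ V y.
Proof.
move=> Ac cy; have [cm yE] := cinv_dom Ac cy.
have [x mE] := proj_surj (cinv c y); rewrite mE in cm yE.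
by have [V [s [lVs]]] := local_section_exists Ac cm; rewrite yE => Vy _; exists V, s.
Qed.

Lemma chart_extension c (x : S3) : atlas c -> cdom c (proj x) ->
  exists2 F : 'rV[R]_4 -> 'rV[R]_3, differentiable F (\val x) &
    \forall z \near x, cfun c (proj z) = F (\val z).
Proof.
move=> [_ /(_ x)] H /H [[U [F [oU Ux sF FE]]] _]; exists F.
  exact: smooth_on_differentiable sF Ux.
have N : \forall z \near x, U (\val z).
  exact: val_continuous (open_nbhs_nbhs (conj oU Ux)).
by apply: filterS N => z /FE.
Qed.

Section OneSection.
Variables (c : chart R L 3) (V : set 'rV[R]_3) (s : 'rV[R]_3 -> S3).
Hypotheses (Ac : atlas c) (lVs : local_section c V s).
Local Notation sv := (fun y => \val (s y)).

Lemma section_near y : V y -> \forall z \near y, V z.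
Proof. by have [oV _ _ _] := lVs => Vy; exact: open_nbhs_nbhs. Qed.

Lemma section_differentiable y : V y -> differentiable sv y.
Proof. by have [_ _ sV _] := lVs; exact: smooth_on_differentiable. Qed.

Lemma section_continuous y : V y -> {for y, continuous s}.
Proof.
by move=> Vy; apply: sphere_continuous; apply: differentiable_continuous;
  exact: section_differentiable.
Qed.

Lemma section_cfun y : V y -> cdom c (proj (s y)) /\ cfun c (proj (s y)) = y.
Proof.
have [_ VI _ sE] := lVs; move=> Vy; rewrite sE //.
by apply: cinv_dom => //; exact: VI.
Qed.

(** The smooth extension [F] of the chart satisfies F (s z) = z near [y]; differentiating shows that
    dF is a left inverse of ds, so ds is injective. *)
Lemma section_retraction y : V y ->
  exists2 F : 'rV[R]_4 -> 'rV[R]_3, differentiable F (sv y) &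
    (forall v, 'D_('D_v sv y) F (sv y) = v) /\
    (\forall z \near s y, cfun c (proj z) = F (\val z)).
Proof.
move=> Vy; have [cs _] := section_cfun Vy.
have [F dF FE] := chart_extension Ac cs; exists F => //; split=> // v.
have ds := section_differentiable Vy.
have Fs : \forall z \near y, z = F (sv z).
  have N : \forall z \near y, cfun c (proj (s z)) = F (sv z).
    exact: section_continuous Vy _ FE.
  by apply: filterS2 N (section_near Vy) => z <- /section_cfun[].
rewrite !deriveE // -[LHS]/(('d F (sv y) \o 'd sv y) v) -diff_comp //.
rewrite (near_eq_diff Fs) ?diff_val //; exact: (@ex_diff _ _ _ _ _ _ _ (is_diff_id y)).
Qed.

Lemma section_tangent y v : V y -> dot (sv y) ('D_v sv y) = 0.
Proof.
move=> Vy; have := derive_dot v (section_differentiable Vy).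
rewrite (_ : (fun x => _) = cst 1); last by apply/funext => z; exact: sphereP.
by rewrite derive_cst => /esym/eqP; rewrite mulf_eq0 pnatr_eq0 /= => /eqP.
Qed.

Lemma section_surjective y (u : 'rV[R]_4) : V y -> dot (sv y) u = 0 ->
  exists v, 'D_v sv y = u.
Proof.
move=> Vy su; have ds := section_differentiable Vy.
have [F dF [FK _]] := section_retraction Vy.
(* ['d s] is injective with image in the orthogonal of [s y], so it is onto that
   3-dimensional space. *)
pose D := lin1_mx ('d sv y); pose E := lin1_mx ('d F (sv y)).
have DE v : v *m D = 'D_v sv y by rewrite mul_rV_lin1 deriveE.
have DK : D *m E = 1%:M.
  apply/row_matrixP => i; rewrite row_mul rowE DE mul_rV_lin1 -deriveE //.
  by rewrite FK rowE mulmx1.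
have rD : \rank D = 3%N.
  by apply/eqP; rewrite -[_ == _]/(row_free D); apply/row_freeP; exists E.
have DS : (D <= kermx (sv y)^T)%MS.
  apply/sub_kermxP/row_matrixP => i; rewrite row_mul rowE DE dot_mulmx.
  by rewrite section_tangent // -scalemx1 scale0r row0.
have rS : \rank (sv y)^T = 1%N.
  rewrite mxrank_tr rank_rV; case: eqVneq => // s0.
  have := sphereP (s y); rewrite s0 sqnormE !crd0 expr0n /= !addr0 => /eqP.
  by rewrite eq_sym oner_eq0.
have : (kermx (sv y)^T <= D)%MS.
  by rewrite -(geq_leqif (mxrank_leqif_sup DS)) mxrank_ker rS rD.
have /submx_trans H : (u <= kermx (sv y)^T)%MS.
  by apply/sub_kermxP; rewrite dot_mulmx su -scalemx1 scale0r.
by move=> /H /submxP[v ->]; exists v; rewrite DE.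
Qed.

End OneSection.
End LocalSections.

(** * The contact form on the lens space *)

Lemma pairing_linear (R : realType) n (a : 'cV[R]_n) k u v :
  pairing a (k *: u + v) = k * pairing a u + pairing a v.
Proof. by rewrite /pairing mulmxDl -scalemxAl !mxE. Qed.

Lemma pairing_col (R : realType) n (f : 'rV[R]_n -> R) v :
  (forall k u w, f (k *: u + w) = k * f u + f w) ->
  pairing (\col_i f (delta_mx 0 i)) v = f v.
Proof.
move=> lf; have f0 : f 0 = 0 by have := lf (-1) 0 0; rewrite scaler0 addr0; lra.
rewrite /pairing mxE [in RHS](row_sum_delta v).
transitivity (\sum_i f (v 0 i *: delta_mx 0 i)).
  by apply: eq_bigr => i _; rewrite mxE -[v 0 i *: _]addr0 lf f0 addr0.
elim/big_rec2: _ => [|i a b _ ->]; first by rewrite f0.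
by have := lf 1 (v 0 i *: delta_mx 0 i) a; rewrite scale1r mul1r.
Qed.

Section LensForm.
Context {R : realType}.
Variables (p q : nat) (mu : R).
Hypotheses (p_gt0 : (0 < p)%N) (co_pq : coprime p q) (mu_gt0 : 0 < mu).
Local Notation S3 := (sphere3 R).
Local Notation L := (lens_space R p q).
Local Notation proj := (@lens_proj R p q).
Local Notation atlas := (lens_atlas R p q).
Local Notation symp := (symp mu).
Local Notation reeb := (reeb mu).
Implicit Types (c d : chart R L 3) (y v w : 'rV[R]_3).

Lemma deriv_linear (V W : normedModType R) (f : V -> W) x k (u v : V) :
  differentiable f x -> 'D_(k *: u + v) f x = k *: 'D_u f x + 'D_v f x.
Proof. by move=> df; rewrite !deriveE // linearP. Qed.

Lemma symp_deriv_linear (f : 'rV[R]_3 -> 'rV[R]_4) y k u v :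
  differentiable f y -> symp (f y) ('D_(k *: u + v) f y) =
  k * symp (f y) ('D_u f y) + symp (f y) ('D_v f y).
Proof. by move=> df; rewrite deriv_linear // sympDr. Qed.

(** Near [y] the two lifts differ by a single deck rotation, which is linear, hence commutes with
    the derivative, and preserves [symp]. *)
Lemma symp_lift_indep (s s' : 'rV[R]_3 -> S3) y v :
  differentiable (fun z => \val (s z)) y ->
  differentiable (fun z => \val (s' z)) y ->
  (\forall z \near y, proj (s z) = proj (s' z)) ->
  symp (\val (s y)) ('D_v (fun z => \val (s z)) y) =
  symp (\val (s' y)) ('D_v (fun z => \val (s' z)) y).
Proof.
move=> ds ds' ss'.
have cs : {for y, continuous s}.
  by apply: sphere_continuous; exact: differentiable_continuous.
have cs' : {for y, continuous s'}.
  by apply: sphere_continuous; exact: differentiable_continuous.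
have [k kE] := lift_unique_deck p_gt0 co_pq cs cs' ss'.
have kE' : \forall z \near y, \val (s' z) = lens_act p q k (\val (s z)).
  by apply: filterS kE => z ->.
rewrite (near_eq_derive _ kE') (nbhs_singleton kE').
have dr : differentiable (lens_act p q k) (\val (s y)) by exact: rot_differentiable.
have -> : 'D_v (fun z => lens_act p q k (\val (s z))) y =
   lens_act p q k ('D_v (fun z => \val (s z)) y).
  rewrite deriveE; last exact: (differentiable_comp (g := lens_act p q k)).
  rewrite (diff_comp (g := lens_act p q k)) //= deriveE //.
  rewrite diff_lin //; exact: rot_continuous.
by rewrite symp_rot.
Qed.

(* The pullback of [symp] along a local section; it does not depend on the
   section because [symp] is invariant under the deck group. *)
Definition lens_form : local_forms R L 3 := fun c y =>
  if pselect (exists Vs, local_section c Vs.1 Vs.2 /\ Vs.1 y) is left h then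
    let s := (projT1 (cid h)).2 in
    \col_i symp (\val (s y)) ('D_(delta_mx 0 i) (fun z => \val (s z)) y)
  else 0.

Lemma lens_formE c V s y v : atlas c -> local_section c V s -> V y ->
  pairing (lens_form c y) v = symp (\val (s y)) ('D_v (fun z => \val (s z)) y).
Proof.
move=> Ac lVs Vy; rewrite /lens_form; case: pselect => [h|]; last first.
  by case; exists (V, s).
case: cid => -[V' s'] /= [lVs' V'y].
have ds := section_differentiable lVs Vy.
have ds' := section_differentiable lVs' V'y.
rewrite (pairing_col (f := fun v =>
  symp (\val (s' y)) ('D_v (fun z => \val (s' z)) y))).
  apply: symp_lift_indep => //.
  have [_ _ _ sE] := lVs; have [_ _ _ sE'] := lVs'.
  apply: filterS2 (section_near lVs Vy) (section_near lVs' V'y) => z /sE -> /sE' ->.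
  by [].
by move=> k u w; exact: symp_deriv_linear.
Qed.

(** [lens_form] chooses a section anew at every point, so its regularity is visible only after the
    choices are replaced by one fixed section on all of [V]. *)
Lemma lens_form_col c V s : atlas c -> local_section c V s ->
  {in V, (fun y => \col_i symp (\val (s y)) ('D_(delta_mx 0 i) (fun z => \val (s z)) y))
     =1 lens_form c}.
Proof.
move=> Ac lVs y /set_mem Vy; apply/colP => i; rewrite !mxE.
have := lens_formE (delta_mx 0 i) Ac lVs Vy.
by rewrite /pairing -rowE mxE => ->.
Qed.

Lemma lens_form_smooth c : atlas c -> smooth_on (cimg c) (lens_form c).
Proof.
move=> Ac vs y cy; have [V [s [lVs Vy]]] := local_section_at Ac cy.
have [oV _ ss _] := lVs.
suff : smooth_on V (lens_form c) by apply.
apply: eq_smooth_on (lens_form_col Ac lVs) _ => //.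
apply: smooth_on_mx => // i j.
pose f k z := crd (\val (s z)) k.
pose g k z := crd ('D_(delta_mx 0 i) (fun z => \val (s z)) z) k.
have sf k : smooth_on V (f k) by exact: smooth_on_entry.
have sg k : smooth_on V (g k).
  by apply: smooth_on_entry => //; exact: smooth_on_derive.
have E z : (\col_i0 symp (\val (s z)) ('D_(delta_mx 0 i0) (fun z => \val (s z)) z)) i j
   = f 0 z * g 1 z + - (f 1 z * g 0 z) + mu^-1 * (f 2 z * g 3 z + - (f 3 z * g 2 z)).
  by rewrite mxE.
rewrite (funext E).
have sB k l : smooth_on V (fun z => f k z * g l z + - (f l z * g k z)).
  by apply: smooth_onD => //; [|apply: smooth_onN => //]; exact: smooth_onM.
apply: smooth_onD => //; apply: smooth_onM => //; exact: cst_smooth_on.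
Qed.

(** Both [s] and the composite of [s'] with the transition map lift [cinv c] near [y], so
    independence of the lift and the chain rule give the change of coordinates. *)
Lemma lens_form_transition c d m : atlas c -> atlas d -> cdom c m -> cdom d m ->
  forall v, pairing (lens_form c (cfun c m)) v =
    pairing (lens_form d (cfun d m)) ('d (transition c d) (cfun c m) v).
Proof.
move=> Ac Ad cm dm v; set y := cfun c m.
have cy : cimg c y by exists m.
have cK : cinv c y = m by have [[_ _ K _ _] _] := Ac; rewrite K.
have [V [s [lVs Vy]]] := local_section_at Ac cy.
have dy : cimg d (cfun d m) by exists m.
have [V' [s' [lVs' Vy']]] := local_section_at Ad dy.
have [_ _ _ sE] := lVs; have [_ _ _ sE'] := lVs'.
have psy : proj (s y) = m by rewrite sE.
have dsy : cdom d (proj (s y)) by rewrite psy.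
have [F dF FE] := chart_extension Ad dsy.
have ds := section_differentiable lVs Vy.
have cs := section_continuous lVs Vy.
have N : \forall z \near y, F (\val (s z)) = transition c d z.
  have N1 : \forall z \near y, cfun d (proj (s z)) = F (\val (s z)) by exact: cs _ FE.
  apply: filterS2 N1 (section_near lVs Vy) => z <- Vz.
  by rewrite /transition /= sE.
have dFs : differentiable (fun z => F (\val (s z))) y.
  exact: (differentiable_comp (g := F)).
have dt : differentiable (transition c d) y by exact: near_eq_differentiable dFs.
have ty : transition c d y = cfun d m by rewrite /transition /= cK.
rewrite (lens_formE v Ac lVs Vy) (lens_formE _ Ad lVs' Vy').
have ds' := section_differentiable lVs' Vy'.
rewrite -ty in ds' Vy' *.
have dst : differentiable (fun z => \val (s' (transition c d z))) y.
  exact: (differentiable_comp (g := fun z => \val (s' z))).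
rewrite (symp_lift_indep _ ds dst).
  congr (symp _ _); rewrite (deriveE _ dst) (deriveE _ ds').
  have E := diff_comp dt ds'.
  exact: (congr1 (fun h : 'rV[R]_3 -> 'rV[R]_4 => h v) E).
have cpm : \forall z \near y, cdom d (cinv c z).
  have [[_ _ _ _ /(_ y cy)]] := Ac; rewrite /prop_for /continuous_at cK => cc _.
  exact: cc _ (near_cdom Ad dm).
have ct : \forall z \near y, V' (transition c d z).
  by apply: (differentiable_continuous dt); exact: (section_near lVs' Vy').
have nV := section_near lVs Vy.
apply: filterS3 nV cpm ct => z Vz dz tz.
by have [[_ _ K _ _] _] := Ad; rewrite sE // sE' // /transition /= K.
Qed.

Lemma lens_one_form : one_form atlas lens_form.
Proof.
split; first exact: lens_form_smooth.
by move=> c d Ac Ad m; exact: lens_form_transition.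
Qed.

Section OneSection.
Variables (c : chart R L 3) (V : set 'rV[R]_3) (s : 'rV[R]_3 -> S3).
Hypotheses (Ac : atlas c) (lVs : local_section c V s).
Local Notation sv := (fun y => \val (s y)).

(** Differentiating [symp (s, 'D_v s)] along [u] leaves a term with the second derivative of [s]. It
    cancels in the antisymmetrization by symmetry of second derivatives. *)
Lemma lens_dformE y u v : V y ->
  dform lens_form c y u v = 2 * symp ('D_u sv y) ('D_v sv y).
Proof.
move=> Vy; have [oV _ ss _] := lVs.
have ds z (Vz : V z) := smooth_on_differentiable ss Vz.
have dd w z (Vz : V z) := smooth_on_differentiable (smooth_on_derive w ss) Vz.
have E w w' : 'D_w (fun z => pairing (lens_form c z) w') y =
    symp ('D_w sv y) ('D_w' sv y) + symp (sv y) ('D_w ('D_w' sv) y).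
  rewrite -derive_symp; [|exact: ds|exact: dd].
  apply: near_eq_derive; apply: filterS (section_near lVs Vy) => z Vz.
  by rewrite (lens_formE _ Ac lVs Vz).
have comm : 'D_u ('D_v sv) y = 'D_v ('D_u sv) y.
  apply/rowP => i.
  have En w w' : 'D_w ('D_w' sv) y 0 i = 'D_w ('D_w' (fun z => sv z 0 i)) y.
    rewrite -derive_entry; last exact: dd.
    apply: near_eq_derive; apply: filterS (section_near lVs Vy) => z Vz.
    by rewrite derive_entry //; exact: ds.
  have si : smooth_on V (fun z => sv z 0 i).
    exact: (smooth_on_entry (f := sv) 0 i oV ss).
  apply: (etrans (En u v) (etrans _ (esym (En v u)))); apply: derive_comm.
  - apply: filterS (section_near lVs Vy) => z; exact: smooth_on_differentiable.
  - exact: smooth_on_differentiable (smooth_on_derive _ si) Vy.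
  - exact: smooth_on_differentiable (smooth_on_derive _ si) Vy.
by rewrite /dform !E comm (symp_antisym mu ('D_v sv y)); ring.
Qed.

Lemma lens_alternating_triple y u v w : V y ->
  let al := pairing (lens_form c y) in let be := dform lens_form c y in
  al u * be v w + al v * be w u + al w * be u v =
  (crd3 u 0 * (crd3 v 1 * crd3 w 2 - crd3 v 2 * crd3 w 1) +
   crd3 u 1 * (crd3 v 2 * crd3 w 0 - crd3 v 0 * crd3 w 2) +
   crd3 u 2 * (crd3 v 0 * crd3 w 1 - crd3 v 1 * crd3 w 0)) *
  contact_volume lens_form c y.
Proof.
move=> Vy /=; apply: alternating_triple.
- exact: pairing_linear.
- move=> k u1 u2 u3; rewrite !(lens_dformE _ _ Vy).
  rewrite (deriv_linear k u1 u2 (section_differentiable lVs Vy)) sympDl.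
  by rewrite mulrDr mulrCA.
- by move=> u1 u2; rewrite !(lens_dformE _ _ Vy) symp_antisym mulrN.
Qed.

(** On the triple formed by the Reeb direction and two tangent vectors [u], [v], the form takes the
    value 1 on the first and its exterior derivative kills it, so the volume reduces to
    [2 * symp u v]. *)
Lemma lens_contact_volume y : V y -> contact_volume lens_form c y != 0.
Proof.
move=> Vy; have s1 := sphereP (s y).
have [u [v [du dv uv]]] := symp_tangent_neq0 mu_gt0 s1.
have [u' uE] := section_surjective Ac lVs Vy du.
have [v' vE] := section_surjective Ac lVs Vy dv.
have [w' wE] := section_surjective Ac lVs Vy (dot_reeb mu (sv y)).
have := lens_alternating_triple w' u' v' Vy; rewrite /= !lens_dformE //.
rewrite uE vE wE (lens_formE w' Ac lVs Vy) wE symp_reeb_diag // s1.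
rewrite [symp v _]symp_antisym !symp_reebl // du dv !oppr0 !mulr0 !addr0 mul1r => E.
by apply: contra_neq uv => v0; move: E; rewrite v0 mulr0; lra.
Qed.

(** Uniqueness is the substantial direction: the difference of two Reeb vectors is killed by the
    form and by its exterior derivative, which a nonzero contact volume forbids unless it
    vanishes. *)
Lemma lens_reeb_vector y w : V y ->
  reeb_vector lens_form c y w <-> 'D_w sv y = reeb (sv y).
Proof.
move=> Vy; have ds := section_differentiable lVs Vy.
have suff_reeb w' : 'D_w' sv y = reeb (sv y) -> reeb_vector lens_form c y w'.
  move=> wE; split=> [v|].
    by rewrite lens_dformE // wE symp_reebl // (section_tangent lVs v Vy) oppr0 mulr0.
  by rewrite (lens_formE w' Ac lVs Vy) wE symp_reeb_diag // sphereP.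
split; last exact: suff_reeb.
move=> [w_ker w_1].
have [w' wE] := section_surjective Ac lVs Vy (dot_reeb mu (sv y)).
have [w'_ker w'_1] := suff_reeb _ wE.
suff -> : w = w' by [].
apply/eqP; rewrite -subr_eq0; apply/eqP; set D := w - w'.
have DE : D = -1 *: w' + w by rewrite scaleN1r addrC.
have alD : pairing (lens_form c y) D = 0 by rewrite DE pairing_linear w_1 w'_1; lra.
have beD v : dform lens_form c y D v = 0.
  rewrite (lens_dformE _ _ Vy) DE (deriv_linear _ _ _ ds) sympDl.
  have := w_ker v; have := w'_ker v; rewrite !(lens_dformE _ _ Vy).
  by move: (symp _ _) (symp _ _) => a b *; lra.
have beD' v : dform lens_form c y v D = 0.
  by rewrite (lens_dformE _ _ Vy) symp_antisym mulrN -(lens_dformE _ _ Vy) beD oppr0.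
have vol0 := lens_contact_volume Vy.
have crd_e i j : (i < 3)%N -> (j < 3)%N -> crd3 (e3 i) j = (i == j)%:R :> R.
  move=> i3 j3; rewrite /crd3 /e3 mxE /= -val_eqE /= !inordK //.
  by rewrite eq_sym.
have D0 v1 v2 := lens_alternating_triple D v1 v2 Vy.
(* With the two other basis vectors as partners of [D], the determinant is the coordinate [i] of
   [D], while the left-hand side is 0. *)
have Z i : (i < 3)%N -> crd3 D i = 0.
  move=> i3; apply: (mulIf vol0); rewrite mul0r.
  case: i i3 => [|[|[|//]]] _.
  - have := D0 (e3 1) (e3 2); rewrite /= alD beD beD' !crd_e //=.
    by rewrite !(mul0r, mulr0, mulr1, addr0, add0r, subr0, oppr0).
  - have := D0 (e3 2) (e3 0); rewrite /= alD beD beD' !crd_e //=.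
    by rewrite !(mul0r, mulr0, mulr1, addr0, add0r, subr0, oppr0).
  - have := D0 (e3 0) (e3 1); rewrite /= alD beD beD' !crd_e //=.
    by rewrite !(mul0r, mulr0, mulr1, addr0, add0r, subr0, oppr0).
by rewrite [D]rV3_sum !Z // !scale0r !addr0.
Qed.

End OneSection.

Lemma lens_contact_form : contact_form atlas lens_form.
Proof.
split; first exact: lens_one_form.
move=> c Ac y cy; have [V [s [lVs Vy]]] := local_section_at Ac cy.
exact: lens_contact_volume lVs _ Vy.
Qed.

End LensForm.

(** * Charts of the lens space *)

Section Stereographic.
Context {R : realType}.
Implicit Types (x z w : 'rV[R]_4) (u : 'rV[R]_3).

(* Right quaternion multiplication by the conjugate of [x], and by [x]: for unit
   [x] the frame carries [x] to the pole (1,0,0,0). *)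
Definition frame x z : 'rV[R]_4 := row4
  (crd x 0 * crd z 0 + crd x 1 * crd z 1 + crd x 2 * crd z 2 + crd x 3 * crd z 3)
  (- crd x 1 * crd z 0 + crd x 0 * crd z 1 - crd x 3 * crd z 2 + crd x 2 * crd z 3)
  (- crd x 2 * crd z 0 + crd x 3 * crd z 1 + crd x 0 * crd z 2 - crd x 1 * crd z 3)
  (- crd x 3 * crd z 0 - crd x 2 * crd z 1 + crd x 1 * crd z 2 + crd x 0 * crd z 3).

Definition unframe x w : 'rV[R]_4 := row4
  (crd x 0 * crd w 0 - crd x 1 * crd w 1 - crd x 2 * crd w 2 - crd x 3 * crd w 3)
  (crd x 1 * crd w 0 + crd x 0 * crd w 1 + crd x 3 * crd w 2 - crd x 2 * crd w 3)
  (crd x 2 * crd w 0 - crd x 3 * crd w 1 + crd x 0 * crd w 2 + crd x 1 * crd w 3)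
  (crd x 3 * crd w 0 + crd x 2 * crd w 1 - crd x 1 * crd w 2 + crd x 0 * crd w 3).

Lemma frame_linear x : linear (frame x).
Proof. by move=> k u v; apply: eq_crd4; rewrite !(crdE, crd_row4) //=; ring. Qed.

Lemma unframe_linear x : linear (unframe x).
Proof. by move=> k u v; apply: eq_crd4; rewrite !(crdE, crd_row4) //=; ring. Qed.

HB.instance Definition _ x :=
  GRing.isLinear.Build R 'rV[R]_4 'rV[R]_4 *:%R (frame x) (frame_linear x).
HB.instance Definition _ x :=
  GRing.isLinear.Build R 'rV[R]_4 'rV[R]_4 *:%R (unframe x) (unframe_linear x).

Lemma unframeK x w : sqnorm x = 1 -> frame x (unframe x w) = w.
Proof.
move=> x1; rewrite -[RHS]scale1r -x1 sqnormE.
by apply: eq_crd4; rewrite !(crdE, crd_row4) //=; ring.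
Qed.

Lemma frameK x z : sqnorm x = 1 -> unframe x (frame x z) = z.
Proof.
move=> x1; rewrite -[RHS]scale1r -x1 sqnormE.
by apply: eq_crd4; rewrite !(crdE, crd_row4) //=; ring.
Qed.

Lemma sqnorm_unframe x w : sqnorm x = 1 -> sqnorm (unframe x w) = sqnorm w.
Proof.
move=> x1; rewrite -[RHS]mul1r -x1 !sqnormE !(crdE, crd_row4) //=; ring.
Qed.

Lemma sqnorm_frame x w : sqnorm x = 1 -> sqnorm (frame x w) = sqnorm w.
Proof. by move=> x1; rewrite -{2}(frameK w x1) sqnorm_unframe. Qed.

Lemma crd_frame0 x z : sqnorm x = 1 -> sqnorm z = 1 ->
  crd (frame x z) 0 = 1 - sqnorm (z - x) / 2.
Proof.
move=> x1 z1; have E : sqnorm (z - x) = sqnorm z + sqnorm x - 2 * crd (frame x z) 0.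
  by rewrite !sqnormE !(crdE, crd_row4) //=; ring.
by rewrite E x1 z1; lra.
Qed.

(** Stereographic projection from (-1,0,0,0), the antipode of the pole to which [frame] carries the
    centre of the chart. *)
Definition stereo w : 'rV[R]_3 := \row_(i < 3) (crd w i.+1 / (1 + crd w 0)).

Definition norm3 u : R := crd3 u 0 ^+ 2 + crd3 u 1 ^+ 2 + crd3 u 2 ^+ 2.

Definition unstereo u : 'rV[R]_4 :=
  row4 ((1 - norm3 u) / (1 + norm3 u)) (2 * crd3 u 0 / (1 + norm3 u))
    (2 * crd3 u 1 / (1 + norm3 u)) (2 * crd3 u 2 / (1 + norm3 u)).

Lemma norm3_neq0 u : 1 + norm3 u != 0.
Proof. by rewrite gt_eqF // ltr_pwDl // !addr_ge0 // sqr_ge0. Qed.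

Lemma sqnorm_unstereo u : sqnorm (unstereo u) = 1.
Proof.
have := norm3_neq0 u; rewrite /unstereo sqnormE !crd_row4 //= {1 2 3 4 5 6}/norm3.
by move=> h; rewrite /norm3; field.
Qed.

Lemma unstereoK u : stereo (unstereo u) = u.
Proof.
have n0 := norm3_neq0 u.
have E : 1 + crd (unstereo u) 0 = 2 / (1 + norm3 u).
  by rewrite /unstereo crd_row4 //=; field.
apply/rowP => i; rewrite mxE E.
have -> : u 0 i = crd3 u i by rewrite /crd3 inord_val.
have i4 : (i.+1 < 4)%N by rewrite ltnS.
rewrite /unstereo crd_row4 //.
case: i {i4} => [[|[|[|//]]] i3] /=; field; exact: n0.
Qed.

Lemma stereoK w : sqnorm w = 1 -> 1 + crd w 0 != 0 -> unstereo (stereo w) = w.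
Proof.
move=> w1 n0; have c3 i : (i < 3)%N -> crd3 (stereo w) i = crd w i.+1 / (1 + crd w 0).
  by move=> i3; rewrite /crd3 mxE inordK.
have w1' : crd w 1 ^+ 2 + crd w 2 ^+ 2 + crd w 3 ^+ 2 = 1 - crd w 0 ^+ 2.
  by move: w1; rewrite sqnormE; lra.
have E : norm3 (stereo w) = (1 - crd w 0) / (1 + crd w 0).
  rewrite /norm3 !c3 // !exprMn -!mulrDl w1' exprVn.
  by field.
have n2 : 2 != 0 :> R by rewrite pnatr_eq0.
have E1 : 1 + norm3 (stereo w) = 2 / (1 + crd w 0) by rewrite E; field.
by apply: eq_crd4; rewrite /unstereo crd_row4 //= E1 ?E ?c3 //; field; rewrite ?n0.
Qed.

Lemma stereo_smooth (V : normedModType R) (f : V -> 'rV[R]_4) (U : set V) :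
  open U -> smooth_on U f -> (forall y, U y -> 1 + crd (f y) 0 != 0) ->
  smooth_on U (fun y => stereo (f y)).
Proof.
move=> oU sf f0; apply: smooth_on_mx => // i j.
have -> : (fun y => stereo (f y) i j) =
    (fun y => crd (f y) j.+1 * (1 + crd (f y) 0)^-1).
  by apply/funext => y; rewrite mxE.
have sc k : smooth_on U (fun y => crd (f y) k).
  exact: (smooth_on_entry 0 (inord k) oU sf).
apply: smooth_onM => //; apply: smooth_onV => //.
  by apply: smooth_onD => //; exact: cst_smooth_on.
by move=> y /set_mem; exact: f0.
Qed.

Lemma unstereo_smooth : smooth_on setT unstereo.
Proof.
have oT : open [set: 'rV[R]_3] by exact: openT.
have sc k : smooth_on setT (fun u => crd3 u k).
  exact: (smooth_on_entry 0 (inord k) oT (rV_linear_smooth idfun oT)).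
have sn : smooth_on setT norm3.
  have s2 k : smooth_on setT (fun u => crd3 u k ^+ 2).
    exact: (smooth_onM oT (sc k) (sc k)).
  exact: (smooth_onD oT (smooth_onD oT (s2 0) (s2 1)) (s2 2)).
have s1 : smooth_on [set: 'rV[R]_3] (cst (1 : R)) by exact: cst_smooth_on.
have sV : smooth_on setT (fun u => (1 + norm3 u)^-1).
  apply: (smooth_onV oT (smooth_onD oT s1 sn)) => u _; exact: norm3_neq0.
have sE k : smooth_on setT (fun u => 2 * crd3 u k / (1 + norm3 u)).
  apply: (smooth_onM oT _ sV); apply: (smooth_onM oT _ (sc k)).
  exact: cst_smooth_on.
have s0 : smooth_on setT (fun u => (1 - norm3 u) / (1 + norm3 u)).
  exact: (smooth_onM oT (smooth_onD oT s1 (smooth_onN oT sn)) sV).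
apply: smooth_on_mx => // i [[|[|[|[|//]]]] j4];
  [move: s0|move: (sE 0)|move: (sE 1)|move: (sE 2)];
  by apply: eq_smooth_on => // u _; rewrite mxE.
Qed.

End Stereographic.

Section LensCharts.
Context {R : realType}.
Variables (p q : nat).
Hypotheses (p_gt0 : (0 < p)%N) (co_pq : coprime p q).
Local Notation S3 := (sphere3 R).
Local Notation L := (lens_space R p q).
Local Notation proj := (@lens_proj R p q).
Local Notation atlas := (lens_atlas R p q).

Fact sphere_chart_subproof (x : S3) (u : 'rV[R]_3) :
  unframe (\val x) (unstereo u) \in S3.
Proof.
apply/mem_set; rewrite /sphere3 /= -/(sqnorm _) sqnorm_unframe ?sphereP //.
exact: sqnorm_unstereo.
Qed.

Definition sphere_param (x : S3) (u : 'rV[R]_3) : S3 :=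
  exist (fun y => y \in S3) _ (sphere_chart_subproof x u).

Definition sphere_coord (x : S3) (z : 'rV[R]_4) : 'rV[R]_3 :=
  stereo (frame (\val x) z).

Lemma sphere_paramK x u : sphere_coord x (\val (sphere_param x u)) = u.
Proof. by rewrite /sphere_coord /= unframeK ?sphereP // unstereoK. Qed.

Lemma frame_pole (x z : S3) : sqnorm (\val z - \val x) < 1 ->
  1 + crd (frame (\val x) (\val z)) 0 != 0.
Proof. by move=> zx; rewrite crd_frame0 ?sphereP // gt_eqF //; lra. Qed.

Lemma sphere_coordK (x z : S3) : sqnorm (\val z - \val x) < 1 ->
  sphere_param x (sphere_coord x (\val z)) = z.
Proof.
move=> zx; apply/val_inj => /=; rewrite /sphere_coord stereoK ?frameK ?sphereP //.
  by rewrite sqnorm_frame ?sphereP.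
exact: frame_pole.
Qed.

Lemma sphere_param_smooth x : smooth_on setT (fun u => \val (sphere_param x u)).
Proof. exact: (smooth_on_linear_comp (unframe (\val x)) openT unstereo_smooth). Qed.

Lemma sphere_param_continuous x : continuous (sphere_param x).
Proof.
move=> u; apply: sphere_continuous; apply: differentiable_continuous.
exact: smooth_on_differentiable (sphere_param_smooth x) _.
Qed.

(** Being a Reeb curve is a condition tested in charts, so it can be exploited only once every point
    is known to lie in one. *)
Lemma lens_chart_exists (x0 : S3) : exists2 c, atlas c & cdom c (proj x0).
Proof.
have [rho rho0 gap] := @proj_gap R _ _ p_gt0 co_pq.
(* The bound [rho / 4] makes the projection injective on [W], and the bound 1 keeps [W] away from
   the centre of the stereographic projection. *)
pose r := Num.min (rho / 4) 1.
have r0 : 0 < r by rewrite lt_min ltr01 divr_gt0.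
have r1 : r <= 1 by rewrite ge_min lexx orbT.
have r4 : r <= rho / 4 by rewrite ge_min lexx.
pose W := [set z : S3 | sqnorm (\val z - \val x0) < r].
have W1 z : W z -> sqnorm (\val z - \val x0) < 1 by move=> Wz; apply: lt_le_trans Wz _.
have contD (T : topologicalType) (f : T -> 'rV[R]_4) : continuous f ->
    continuous (fun t => sqnorm (f t - \val x0)).
  move=> cf t; apply: (@continuous_comp _ _ _ (fun t => f t - \val x0) sqnorm).
    by apply: continuousB; [exact: cf|exact: cst_continuous].
  exact: sqnorm_continuous.
have oW : open W.
  apply: (@open_comp _ _ (fun z : S3 => sqnorm (\val z - \val x0)) [set t | t < r]).
    by move=> z _; apply: contD; exact: val_continuous.
  exact: open_lt.
have Wx0 : W x0.
  by rewrite /W /= subrr (_ : sqnorm _ = 0) // sqnormE !crd0 expr0n /= !addr0.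
have Winj z z' : W z -> W z' -> proj z = proj z' -> z = z'.
  move=> Wz Wz' /gap; apply; rewrite -(subrKA (\val x0)).
  apply: le_lt_trans (sqnormD_le _ _) _; move: Wz Wz'; rewrite /W /=.
  by rewrite -[sqnorm (_ - \val z')]sqnormN opprB; lra.
pose pick m := xget x0 [set z | W z /\ proj z = m].
have pickE z : W z -> pick (proj z) = z.
  move=> Wz; rewrite /pick; case: xgetP => [y yE [Wy py]|/(_ z)]; first exact: Winj.
  by case.
pose c := Chart (proj @` W) (fun m => sphere_coord x0 (\val (pick m)))
  (fun u => proj (sphere_param x0 u)).
have cE z : W z -> cfun c (proj z) = sphere_coord x0 (\val z).
  by move=> Wz; rewrite /= pickE.
have imgE : cimg c = sphere_param x0 @^-1` W.
  apply/seteqP; split=> [_ [_ [z Wz <-] <-]|u Wu].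
    by rewrite cE // /preimage /= sphere_coordK //; exact: W1.
  exists (proj (sphere_param x0 u)); first by exists (sphere_param x0 u).
  by rewrite cE // sphere_paramK.
(* The atlas condition is required at every point above the chart domain, not only in [W]. Such a
   point is moved into [W] by a deck transformation first, and [f k] is the denominator of the
   coordinates composed with it. *)
pose f k (y : 'rV[R]_4) := 1 + crd (frame (\val x0) (lens_act p q k y)) 0.
have sfr k U : open U -> smooth_on U (fun y => frame (\val x0) (lens_act p q k y)).
  move=> oU; apply: (smooth_on_linear_comp (frame (\val x0)) oU).
  exact: (rV_linear_smooth (diag_rot _ _) oU).
have cf k : continuous (f k).
  move=> y; apply: differentiable_continuous.
  apply: (smooth_on_differentiable (U := setT)) => //.
  apply: (smooth_onD openT); first exact: (cst_smooth_on _ openT).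
  exact: (smooth_on_entry 0 (inord 0) openT (sfr k _ openT)).
have oU k : open [set y | f k y != 0].
  apply: (@open_comp _ _ (f k) [set t | t != 0]) => [y _|]; first exact: cf.
  exact: open_neq.
have coord_smooth k : smooth_on [set y | f k y != 0]
    (fun y => sphere_coord x0 (lens_act p q k y)).
  by apply: stereo_smooth => //; apply: sfr.
have fW k z : W (deck p q k z) -> f k (\val z) != 0.
  by move=> Wz; apply: (@frame_pole x0 (deck p q k z)); exact: W1.
exists c; last by exists x0.
split.
  split.
  - by apply lens_proj_open.
  - rewrite imgE; apply: open_comp => // u _; exact: sphere_param_continuous.
  - by move=> _ [z Wz <-]; rewrite cE //= sphere_coordK //; exact: W1.
  - move=> _ [z Wz <-] O; rewrite cE // => nO.
    have dz : differentiable (sphere_coord x0) (\val z).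
      have E : sphere_coord x0 = (fun y => sphere_coord x0 (lens_act p q 0 y)).
        by apply/funext => y; rewrite lens_act0.
      rewrite E; apply: smooth_on_differentiable (coord_smooth 0) _.
      by apply: fW; rewrite deck0.
    have : nbhs z [set z' : S3 | W z' /\ O (sphere_coord x0 (\val z'))].
      apply: filterI; first exact: open_nbhs_nbhs.
      have := differentiable_continuous dz nO.
      exact: (@val_continuous R z).
    rewrite (@nbhsE S3) => -[B [oB Bz] BWO].
    have : nbhs (proj z) (proj @` B).
      by apply: open_nbhs_nbhs; split; [apply lens_proj_open|exists z].
    suff BO : proj @` B `<=` (cfun c @^-1` O) by move=> N; exact: filterS BO N.
    by move=> _ [z' /BWO[Wz' Oz'] <-]; rewrite /preimage /= pickE.
  - move=> u _; apply: continuous_comp; first exact: sphere_param_continuous.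
    exact: lens_proj_continuous.
move=> x [z Wz /projP[k xE]].
have zE : z = deck p q (- k) x by rewrite xE deckD addNr deck0.
split.
  have cL : continuous (fun y => lens_act p q (- k) y : 'rV[R]_4).
    exact: rot_continuous.
  exists ([set y | f (- k) y != 0] `&`
    [set y | sqnorm (lens_act p q (- k) y - \val x0) < r]).
  exists (fun y => sphere_coord x0 (lens_act p q (- k) y)); split.
  - apply: openI => //.
    apply: (@open_comp _ _ (fun y => sqnorm (lens_act p q (- k) y - \val x0))
      [set t | t < r]).
      by move=> y _; exact: contD.
    exact: open_lt.
  - by split; [apply: fW; rewrite -zE|rewrite /= -val_deck -zE].
  - by apply: sub_smooth_on (coord_smooth _) => y [].
  - by move=> y [_ Wy]; rewrite -val_deck -cE // proj_deck.
exists setT, (fun u => deck p q k (sphere_param x0 u)); split=> //.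
- exact: openT.
- exact: (smooth_on_linear_comp (diag_rot _ _) openT (sphere_param_smooth x0)).
- rewrite xE proj_deck cE // sphere_coordK //; exact: W1.
- by move=> u _; rewrite proj_deck.
Qed.

End LensCharts.

(** * The Reeb flow *)

Section Curves.
Context {R : realType}.

Lemma is_derive_crd (f : R -> 'rV[R]_4) f' (t : R) i :
  is_derive t 1 f f' -> is_derive t 1 (fun u => crd (f u) i) (crd f' i).
Proof.
move=> [df <-]; split; first by move/derivable_mxP : df; apply.
by rewrite derive_mx // /crd mxE.
Qed.

Lemma is_derive_rV4 (f : R -> 'rV[R]_4) f' (t : R) :
  (forall i, (i < 4)%N -> is_derive t 1 (fun u => crd (f u) i) (crd f' i)) ->
  is_derive t 1 f f'.
Proof.
move=> H; have {}H (i : 'I_1) (j : 'I_4) : is_derive t 1 (fun u => f u i j) (f' i j).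
  by have := H j (ltn_ord j); rewrite /crd inord_val !ord1.
have df : derivable f t 1 by apply/derivable_mxP => i j; have [] := H i j.
split=> //; rewrite derive_mx //; apply/matrixP => i j; rewrite mxE.
by have [] := H i j.
Qed.

Definition spin (a b : R) (z : 'rV[R]_4) : 'rV[R]_4 :=
  row4 (- (a * crd z 1)) (a * crd z 0) (- (b * crd z 3)) (b * crd z 2).

Lemma is_derive_cossin (a t : R) :
  is_derive t 1 (fun u => cos (a * u)) (- (a * sin (a * t))) /\
  is_derive t 1 (fun u => sin (a * u)) (a * cos (a * t)).
Proof.
have da : is_derive t 1 (fun u : R => a * u) a.
  have [h1 h2] := is_deriveZ a (is_derive_id t 1).
  by split=> //; rewrite h2 /GRing.scale /= mulr1.
split.
  have [h1 h2] := is_derive1_comp (is_derive_cos (a * t)) da.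
  by split=> //; rewrite h2 /GRing.scale /=; ring.
have [h1 h2] := is_derive1_comp (is_derive_sin (a * t)) da.
by split=> //; rewrite h2 /GRing.scale /=; ring.
Qed.

(** Product rule in a rotating frame: [spin a b] generates the rotation and commutes with it, so the
    whole derivative fits under the rotation. *)
Lemma is_derive_rot (a b : R) (f : R -> 'rV[R]_4) f' (t : R) :
  is_derive t 1 f f' ->
  is_derive t 1 (fun u => diag_rot (a * u) (b * u) (f u))
    (diag_rot (a * t) (b * t) (f' + spin a b (f t))).
Proof.
move=> df; have [ca sa] := is_derive_cossin a t; have [cb sb] := is_derive_cossin b t.
have F i := is_derive_crd i df.
have E (g : R -> 'rV[R]_4) i (h : R -> R) : (forall u, crd (g u) i = h u) ->
    (fun u => crd (g u) i) = h by move=> gh; apply/funext.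
apply: is_derive_rV4; case=> [|[|[|[|//]]]] _;
  rewrite crd_rot // !crdE /spin !crd_row4 //=.
- have [h1 h2] := is_deriveB (is_deriveM ca (F 0)) (is_deriveM sa (F 1)).
  rewrite (E _ _ _ (fun u => crd_rot _ _ _ _)) //=; split; first exact: h1.
  by rewrite [LHS]h2 /GRing.scale /=; ring.
- have [h1 h2] := is_deriveD (is_deriveM sa (F 0)) (is_deriveM ca (F 1)).
  rewrite (E _ _ _ (fun u => crd_rot _ _ _ _)) //=; split; first exact: h1.
  by rewrite [LHS]h2 /GRing.scale /=; ring.
- have [h1 h2] := is_deriveB (is_deriveM cb (F 2)) (is_deriveM sb (F 3)).
  rewrite (E _ _ _ (fun u => crd_rot _ _ _ _)) //=; split; first exact: h1.
  by rewrite [LHS]h2 /GRing.scale /=; ring.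
- have [h1 h2] := is_deriveD (is_deriveM sb (F 2)) (is_deriveM cb (F 3)).
  rewrite (E _ _ _ (fun u => crd_rot _ _ _ _)) //=; split; first exact: h1.
  by rewrite [LHS]h2 /GRing.scale /=; ring.
Qed.

Lemma derive0_locally_cst (f : R -> R) (t0 e : R) :
  (forall t, `|t - t0| < e -> is_derive t 1 f 0) ->
  forall t, `|t - t0| < e -> f t = f t0.
Proof.
move=> df; have key x y : x <= y -> (forall u, x <= u <= y -> `|u - t0| < e) ->
    f y = f x.
  move=> xy xye.
  have dfu u : u \in `]x, y[ -> is_derive u 1 f ((fun=> 0) u).
    rewrite in_itv /= => /andP[xu uy]; apply: df; apply: xye.
    by rewrite !ltW.
  have [|c _] := MVT_segment xy dfu.
    apply: derivable_within_continuous => u; rewrite in_itv /= => xuy.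
    by have [] := df u (xye u xuy).
  by rewrite mul0r => /eqP; rewrite subr_eq0 => /eqP.
move=> t te; have [tt0|t0t] := leP t t0.
  apply/esym/key => // u /andP[tu ut]; apply: le_lt_trans te.
  by rewrite !ler0_norm ?subr_le0 //; lra.
apply: key; first exact: ltW.
move=> u /andP[tu ut]; apply: le_lt_trans te.
by rewrite !ger0_norm ?subr_ge0 //; lra.
Qed.

Lemma locally_cst_cst (T : Type) (f : R -> T) :
  (forall t, \forall u \near t, f u = f t) -> forall t, f t = f 0.
Proof.
move=> lf; pose B := [set t | f t = f 0].
have oB : open B.
  by rewrite openE => t Bt; have := lf t; apply: filterS => u fu; rewrite /B /= fu.
have cB : closed B.
  rewrite -[B]setCK; apply: open_closedC; rewrite openE => t Bt.
  by have := lf t; apply: filterS => u uE Bu; apply: Bt; rewrite /B /= -uE.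
have : connected [set: R] by apply/connected_intervalP => x y z.
move=> /(_ B) BT t.
have BE : B = [set: R].
  apply: BT; first by exists 0.
    by exists B => //; rewrite setTI.
  by exists B => //; rewrite setTI.
by have : [set: R] t by []; rewrite -BE.
Qed.

End Curves.

Section ReebFlow.
Context {R : realType}.
Variables (p q : nat) (mu : R).
Hypotheses (p_gt0 : (0 < p)%N) (co_pq : coprime p q) (mu_gt0 : 0 < mu).
Local Notation S3 := (sphere3 R).
Local Notation L := (lens_space R p q).
Local Notation proj := (@lens_proj R p q).
Local Notation atlas := (lens_atlas R p q).
Local Notation form := (@lens_form R p q mu).
Local Notation reeb := (reeb mu).

Definition sflow (t : R) : S3 -> S3 := srot t (mu * t).

Lemma sflow0 x : sflow 0 x = x.
Proof. by rewrite /sflow mulr0 srot0. Qed.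

Lemma sflowD s t x : sflow s (sflow t x) = sflow (s + t) x.
Proof. by rewrite /sflow srotD mulrDr. Qed.

Lemma sflow_deck t k x : sflow t (deck p q k x) = deck p q k (sflow t x).
Proof. by rewrite /sflow /deck !srotD [t + _]addrC [mu * t + _]addrC. Qed.

Definition lens_flow (t : R) (m : L) : L := proj (sflow t (lens_repr m)).

(** The flow and the deck transformations are diagonal rotations and commute, so the chosen
    representative does not matter. *)
Lemma lens_flow_proj t x : lens_flow t (proj x) = proj (sflow t x).
Proof.
rewrite /lens_flow.
have /projP[k {2}->] : proj (lens_repr (proj x)) = proj x := lens_reprK _.
by rewrite sflow_deck proj_deck.
Qed.

Lemma lens_flowD s t m : lens_flow s (lens_flow t m) = lens_flow (s + t) m.
Proof. by have [x ->] := proj_surj m; rewrite !lens_flow_proj sflowD. Qed.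

Lemma lens_flow0 m : lens_flow 0 m = m.
Proof. by have [x ->] := proj_surj m; rewrite lens_flow_proj sflow0. Qed.

Lemma is_derive_sflow (T t : R) (x : S3) :
  is_derive t 1 (fun u => \val (sflow (T * u) x)) (T *: reeb (\val (sflow (T * t) x))).
Proof.
have H := is_derive_rot T (mu * T) (is_derive_cst (\val x) t (1 : R)).
rewrite (_ : (fun u => _) = fun u => diag_rot (T * u) (mu * T * u) (\val x));
  last first.
  by apply/funext => u; rewrite /= mulrA.
apply: is_derive_eq H _ => /=; rewrite add0r mulrA.
apply: eq_crd4; do 3 rewrite ?(crdE, crd_rot, crd_row4) //=; ring.
Qed.

Lemma sflow_continuous (T : R) (x : S3) : continuous (fun t => sflow (T * t) x).
Proof.
move=> t; apply: sphere_continuous.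
apply: (@differentiable_continuous _ _ _ _ (fun u => \val (sflow (T * u) x))).
by apply/derivable1_diffP; have [] := is_derive_sflow T t x.
Qed.

Lemma lens_flow_reeb_curve T m : reeb_curve atlas form T (fun t => lens_flow (T * t) m).
Proof.
have [x ->] := proj_surj m.
have -> : (fun t => lens_flow (T * t) (proj x)) = (fun t => proj (sflow (T * t) x)).
  by apply/funext => t; rewrite lens_flow_proj.
split=> [t|t c Ac ct].
  exact: (continuous_comp (@sflow_continuous T x t) (@lens_proj_continuous R p q _)).
have [V [s [lVs Vy sy]]] := local_section_exists Ac ct.
set y := cfun c _ in Vy sy.
have [F dF [FK FE]] := section_retraction Ac lVs Vy.
have [w wE] := section_surjective Ac lVs Vy (dot_reeb mu (\val (s y))).
exists w; first exact/(lens_reeb_vector p_gt0 co_pq mu_gt0 Ac lVs _ Vy).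
rewrite sy in dF FK FE wE.
have D := is_derive_curve_comp (is_derive_sflow T t x) dF.
have N : \forall u \near t, (F \o (fun u => \val (sflow (T * u) x))) u =
    (cfun c \o (fun t0 => proj (sflow (T * t0) x))) u.
  have : \forall u \near t,
      cfun c (proj (sflow (T * u) x)) = F (\val (sflow (T * u) x)).
    exact: (@sflow_continuous T x t _ FE).
  by apply: filterS => u E; exact: esym E.
apply: near_eq_is_derive N _; apply: is_derive_eq D _.
by rewrite deriveE // linearZ /= -deriveE // -wE FK.
Qed.

Lemma lens_flow_reeb_flow : reeb_flow atlas form lens_flow.
Proof.
move=> m; split; first exact: lens_flow0.
have := lens_flow_reeb_curve 1 m.
by rewrite (_ : (fun t => _) = lens_flow ^~ m) //; apply/funext => t; rewrite mul1r.
Qed.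

(** Uniqueness of Reeb trajectories. A local lift of the curve satisfies a linear equation whose
    right-hand side is the generator of the flow; rotating the lift back cancels it, and
    connectedness of R globalizes the result. *)
Lemma reeb_curve_flow T (g : R -> L) : reeb_curve atlas form T g ->
  forall t, g t = lens_flow (T * t) (g 0).
Proof.
move=> [cg dg].
(* Undoing the flow along [g] gives a locally constant curve. *)
suff G t : lens_flow (- T * t) (g t) = lens_flow (- T * 0) (g 0).
  move=> t; rewrite -[g 0]lens_flow0 -[X in lens_flow X (g 0)](mulr0 (- T)) -(G t).
  by rewrite lens_flowD mulNr addrN lens_flow0.
apply: (@locally_cst_cst _ _ (fun t => lens_flow (- T * t) (g t))) => {}t.
have [x0 gt] := proj_surj (g t).
have [c Ac cx] := lens_chart_exists p_gt0 co_pq x0.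
have [V [s [lVs Vy sy]]] := local_section_exists Ac cx.
rewrite -gt in cx Vy sy.
have [[oc _ cK cc _] _] := Ac.
have N : \forall u \near t, cdom c (g u) /\ V (cfun c (g u)).
  apply: filterI; first exact: cg _ _ (near_cdom Ac cx).
  have C : {for t, continuous (cfun c \o g)} := continuous_comp (cg t) (cc _ cx).
  exact: C _ (section_near lVs Vy).
pose h u := s (cfun c (g u)).
have hE u : cdom c (g u) -> V (cfun c (g u)) -> proj (h u) = g u.
  by have [_ _ _ sE] := lVs; move=> cu Vu; rewrite /h sE // cK.
have dh u : cdom c (g u) -> V (cfun c (g u)) ->
    is_derive u 1 (fun u => \val (h u)) (T *: reeb (\val (h u))).
  move=> cu Vu; have [w wr dw] := dg u c Ac cu.
  have wE := (lens_reeb_vector p_gt0 co_pq mu_gt0 Ac lVs w Vu).1 wr.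
  have ds := section_differentiable lVs Vu.
  have := is_derive_curve_comp dw ds.
  by rewrite deriveE // linearZ /= -deriveE // wE.
have /nbhs_ballP[e /= e0 He] : nbhs t _ := N.
have psiE u : `|u - t| < e -> sflow (- T * u) (h u) = sflow (- T * t) (h t).
  move=> ue; apply/val_inj; apply: eq_crd => i _.
  apply: (@derive0_locally_cst _ (fun u => crd (\val (sflow (- T * u) (h u))) i)
    t e) => // {}u {}ue.
  have [cu Vu] : cdom c (g u) /\ V (cfun c (g u)).
    by apply: He; rewrite -ball_normE /= distrC.
  have D := is_derive_rot (- T) (mu * - T) (dh u cu Vu).
  have := is_derive_crd i D.
  rewrite (_ : _ + _ = 0); last first.
    by apply: eq_crd4; rewrite !(crdE, crd_row4) //=; ring.
  rewrite linear0 crd0.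
  by rewrite (_ : (fun u => _) = (fun u => crd (\val (sflow (- T * u) (h u))) i)) //;
     apply/funext => v; rewrite /= mulrA.
have NB : \forall u \near t, ball t e u by exact: nbhsx_ballx.
have [ct Vt] := nbhs_singleton N.
apply: filterS2 N NB => u [cu Vu] /= tu.
rewrite -(hE u) // -[in RHS](hE t) // !lens_flow_proj psiE //.
by rewrite distrC; move: tu; rewrite -ball_normE.
Qed.

End ReebFlow.

(** * Closed orbits *)

Section Angles.
Context {R : realType}.

Lemma angle_exists (a b : R) : a ^+ 2 + b ^+ 2 = 1 ->
  exists s, a = cos s /\ b = sin s.
Proof.
move=> ab; have a1 : -1 <= a <= 1.
  rewrite -ler_norml -(@ler_pXn2r _ 2) ?nnegrE //= real_normK ?num_real //.
  by rewrite expr1n -ab lerDl sqr_ge0.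
have ca : cos (acos a) = a by apply: acosK; rewrite in_itv.
have sa : sin (acos a) = `|b|.
  by rewrite sin_acos // -ab addrC addKr sqrtr_sqr.
have [b0|b0] := ger0P b.
  by exists (acos a); rewrite ca sa ger0_norm.
by exists (- acos a); rewrite cosN sinN ca sa ltr0_norm // opprK.
Qed.

Lemma rot_fixed (s t : R) (z : 'rV[R]_4) : diag_rot s t z = z ->
  (cos s = 1 \/ (crd z 0 = 0 /\ crd z 1 = 0)) /\
  (cos t = 1 \/ (crd z 2 = 0 /\ crd z 3 = 0)).
Proof.
move=> fz; have := sqnorm_rot_sub s t z.
rewrite fz subrr (_ : sqnorm _ = 0); last by rewrite sqnormE !crd0 expr0n /= !addr0.
have c0 u : 0 <= 2 - 2 * cos u :> R by have := cos_le1 u; lra.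
have q0 i j : 0 <= crd z i ^+ 2 + crd z j ^+ 2 by rewrite addr_ge0 ?sqr_ge0.
move=> /esym/eqP; rewrite paddr_eq0 ?mulr_ge0 // => /andP[].
have key u i j : (2 - 2 * cos u) * (crd z i ^+ 2 + crd z j ^+ 2) == 0 ->
    cos u = 1 \/ (crd z i = 0 /\ crd z j = 0).
  rewrite mulf_eq0 => /orP[/eqP ?|]; first by left; lra.
  by rewrite paddr_eq0 ?sqr_ge0 // !sqrf_eq0 => /andP[/eqP -> /eqP ->]; right.
by move=> /key ? /key ?; split.
Qed.

End Angles.

Section ClosedOrbits.
Context {R : realType}.
Variables (p q : nat) (mu : R).
Hypotheses (p_gt0 : (0 < p)%N) (co_pq : coprime p q) (mu_gt0 : 0 < mu).
Hypothesis mu_irr : forall a b : int, mu * a%:~R = b%:~R -> a = 0.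
Local Notation S3 := (sphere3 R).
Local Notation L := (lens_space R p q).
Local Notation proj := (@lens_proj R p q).
Local Notation atlas := (lens_atlas R p q).
Local Notation form := (@lens_form R p q mu).
Local Notation flow := (@sflow R mu).
Local Notation lflow := (@lens_flow R p q mu).
Local Notation ang1 k := (2 * pi * k%:~R / p%:R : R).
Local Notation ang2 k := (2 * pi * k%:~R * q%:R / p%:R : R).

Lemma closed_orbit_flow T g : closed_orbit atlas form T g ->
  exists x k, [/\ 0 < T, g 0 = proj x, forall t, g t = proj (flow (T * t) x) &
    flow T x = deck p q k x].
Proof.
move=> [T0 per /(reeb_curve_flow p_gt0 co_pq mu_gt0) gE].
have [x g0] := proj_surj (g 0).
have {}gE t : g t = proj (flow (T * t) x) by rewrite gE g0 lens_flow_proj.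
have /esym/projP[k kE] : proj (flow T x) = proj x.
  by rewrite -g0 -(per 0) add0r gE mulr1.
by exists x, k.
Qed.

Lemma flow_closed_orbit T x : 0 < T -> proj (flow T x) = proj x ->
  closed_orbit atlas form T (fun t => proj (flow (T * t) x)).
Proof.
move=> T0 per; split=> // [t|].
  by rewrite mulrDr mulr1 -sflowD -lens_flow_proj per lens_flow_proj.
have := lens_flow_reeb_curve p_gt0 co_pq mu_gt0 T (proj x).
have E : (fun t => lflow (T * t) (proj x)) = (fun t => proj (flow (T * t) x)).
  by apply/funext => t; rewrite lens_flow_proj.
by rewrite E.
Qed.

(** Both [T] and [mu * T] would be integer multiples of 2 pi / p, and their ratio [mu] is
    irrational, so [T] would be 0. *)
Lemma period_incommensurable T k : 0 < T -> cos (T - ang1 k) = 1 ->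
  cos (mu * T - ang2 k) = 1 -> False.
Proof.
move=> T0 /cos_eq1[m mE] /cos_eq1[n nE].
have p0 : p%:R != 0 :> R by rewrite pnatr_eq0 -lt0n.
have pi0 : pi != 0 :> R by rewrite gt_eqF ?pi_gt0.
have TE : T = 2 * pi / p%:R * (k + m * p%:Z)%:~R.
  by rewrite intrD intrM -pmulrn -[LHS](subrK (ang1 k)) mE; field.
have muTE : mu * T = 2 * pi / p%:R * (k * q%:Z + n * p%:Z)%:~R.
  by rewrite intrD !intrM -!pmulrn -[LHS](subrK (ang2 k)) nE; field.
have c0 : 2 * pi / p%:R != 0 :> R.
  by rewrite mulf_neq0 ?invr_eq0 // mulf_neq0 // pnatr_eq0.
have /mu_irr km : mu * (k + m * p%:Z)%:~R = (k * q%:Z + n * p%:Z)%:~R.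
  by apply: (mulfI c0); rewrite -muTE TE mulrCA.
by move: T0; rewrite TE km mulr0 ltxx.
Qed.

(** * Orbits whose return times are the multiples of P *)

Section Period.
Variables (x : S3) (P : R).
Hypotheses (P0 : 0 < P)
  (HP : forall t, proj (flow t x) = proj x <-> exists j : int, t = P * j%:~R).

Lemma period_closed b :
  closed_orbit atlas form P (fun t => proj (flow (P * t) (flow b x))).
Proof.
apply: flow_closed_orbit => //; rewrite sflowD addrC -sflowD -!lens_flow_proj.
by congr lens_flow; rewrite lens_flow_proj; apply/HP; exists 1; rewrite mulr1.
Qed.

(** If the orbit were a [k]-fold cover, [P / k] would be a return time, hence an integer multiple of
    [P], and [k] would divide 1. *)
Lemma period_simple : simple_closed_orbit atlas form P (fun t => proj (flow (P * t) x)).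
Proof.
split; first by have := period_closed 0; rewrite sflow0.
move=> [T [h [k [[_ per _] k2 hE]]]].
have k0 : k%:R != 0 :> R by rewrite pnatr_eq0; case: k k2 {hE}.
have : proj (flow (P / k%:R) x) = proj x.
  rewrite hE mulfV // -[X in h X]add0r per.
  by have := hE 0; rewrite !mulr0 sflow0 => <-.
move=> /HP[j jE].
have : (k%:Z * j)%:~R = 1%:~R :> R.
  rewrite intrM -pmulrn; apply: (mulfI (lt0r_neq0 P0)).
  by rewrite mulrCA -jE mulr1 mulrC divfK.
move=> /intr_inj kj; have : (k%:Z %| 1)%Z by apply/dvdzP; exists j; rewrite mulrC kj.
by rewrite dvdz1 absz_nat => /eqP k1; rewrite k1 in k2.
Qed.

(** The period of [g] is [P * j] with [j] positive. A value of [j] above 1 would present [g] as a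
    multiple cover, and for [j] equal to 1 the starting point accounts for the shift [b / P]. *)
Lemma period_classify T g b : simple_closed_orbit atlas form T g ->
  g 0 = proj (flow b x) -> same_orbit (fun t => proj (flow (P * t) x)) g.
Proof.
move=> [gc gs] g0; have [T0 per gr] := gc.
have gE t : g t = proj (flow (T * t) (flow b x)).
  by rewrite (reeb_curve_flow p_gt0 co_pq mu_gt0 gr) g0 lens_flow_proj.
have /HP[j jE] : proj (flow T x) = proj x.
  have : g 1 = g 0 by rewrite -(per 0) add0r.
  rewrite g0 gE mulr1 sflowD => /(congr1 (lflow (- b))).
  by rewrite !lens_flow_proj !sflowD addrCA addNr addr0 sflow0.
case: j jE => j jE; last first.
  by move: T0; rewrite jE NegzE mulrNz mulrN oppr_gt0 ltNge mulr_ge0 // ltW.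
case: j jE => [|[|j]] jE.
- by move: T0; rewrite jE mulr0 ltxx.
- exists (b / P) => t; rewrite gE jE mulr1 sflowD mulrDr mulrCA mulfV ?gt_eqF //.
  by rewrite mulr1.
- case: gs; exists P, (fun t => proj (flow (P * t) (flow b x))), j.+2.
  by split=> // [|t]; [exact: period_closed|rewrite gE jE -pmulrn mulrA].
Qed.

End Period.

(** The rotation [A] lifts the return map and fixes [x]. An eigenvector in the contact plane lifts
    to a nonzero [U] fixed by [A], with [dot] and [symp] against [x] both zero. At most one angle of
    [A] is trivial, so [U] lies in the same complex plane as [x], and there the two equations force
    it to vanish. *)
Lemma orbit_nondegenerate T g : closed_orbit atlas form T g ->
  nondegenerate_orbit atlas form T g.
Proof.
move=> /closed_orbit_flow[x [k [T0 g0 gE xk]]].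
exists lflow; first exact: lens_flow_reeb_flow.
move=> c Ac; rewrite g0 => cx.
have [V [s [lVs Vy sy]]] := local_section_exists Ac cx.
move: Vy sy; set y := cfun c (proj x) => Vy sy.
have [_ _ _ sE] := lVs; have [[_ _ cK _ _] _] := Ac.
pose sg := T - ang1 k; pose ta := mu * T - ang2 k.
pose A : S3 -> S3 := srot sg ta.
have AE z : A z = deck p q (- k) (flow T z).
  rewrite /A /deck /sflow srotD /sg /ta; congr srot; rewrite mulrNz; ring.
have Ax : A x = x by rewrite AE xk deckD addNr deck0.
have pA z : proj (A z) = lflow T (proj z) by rewrite AE proj_deck lens_flow_proj.
set psi := cfun c \o lflow T \o cinv c.
have [F dF [FK FE]] := section_retraction Ac lVs Vy.
have ds := section_differentiable lVs Vy.
have cs := section_continuous lVs Vy.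
have dA z : differentiable (diag_rot sg ta) z := rot_differentiable _ _ _.
have cAs : {for y, continuous (A \o s)}.
  by apply: continuous_comp => //; exact: srot_continuous.
have dAs : differentiable (fun z => \val (A (s z))) y.
  exact: (differentiable_comp (g := diag_rot sg ta)).
have Asy : A (s y) = x by rewrite sy Ax.
have Vn := section_near lVs Vy.
have psiE z : V z -> psi z = cfun c (proj (A (s z))).
  by move=> Vz; rewrite /psi /= pA sE.
have psiy : psi y = y by rewrite psiE // Asy.
have psiF : \forall z \near y, F (\val (A (s z))) = psi z.
  have N : \forall z \near y, cfun c (proj (A (s z))) = F (\val (A (s z))).
    have FA : \forall z \near A (s y), cfun c (proj z) = F (\val z) by rewrite Asy -sy.
    exact: cAs _ FA.
  by apply: filterS2 N Vn => z <- Vz; rewrite psiE.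
have dpsi : differentiable psi y.
  apply: near_eq_differentiable psiF _.
  have dFA : differentiable F (\val (A (s y))) by rewrite Asy -sy.
  exact: (differentiable_comp dAs dFA).
split=> // -[v [v0 av dv]].
have cpsi : {for y, continuous psi} by exact: differentiable_continuous.
(* Both sides lift [cinv c \o psi] and equal [x] at [y]; hence dpsi v = v gives
   A (ds v) = ds v. *)
have lift_eq : \forall z \near y, s (psi z) = A (s z).
  apply: (@lift_unique _ _ _ p_gt0 co_pq _ (s \o psi) (A \o s)) => //.
  - by apply: continuous_comp => //; rewrite psiy.
  - by rewrite /= psiy Asy.
  have N1 : \forall z \near y, V (psi z).
    have Vp : \forall z \near psi y, V z by rewrite psiy.
    exact: cpsi _ Vp.
  have N2 : \forall z \near y, cdom c (proj (A (s z))).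
    have C : {for y, continuous (proj \o (A \o s))}.
      apply: continuous_comp => //; exact: lens_proj_continuous.
    have D : \forall m \near proj (A (s y)), cdom c m by rewrite Asy; exact: near_cdom.
    exact: C _ D.
  by apply: filterS3 Vn N1 N2 => z Vz Vpz cz /=; rewrite sE // psiE // cK.
set U := 'D_v (fun z => \val (s z)) y.
have AU : diag_rot sg ta U = U.
  have dspsi : differentiable (fun z => \val (s z)) (psi y) by rewrite psiy.
  have E1 : 'D_v (fun z => \val (s (psi z))) y = U.
    rewrite deriveE; last first.
      exact: (differentiable_comp (f := psi) (g := fun z => \val (s z))).
    have E := diff_comp dpsi dspsi.
    apply: (etrans (congr1 (fun h : 'rV[R]_3 -> 'rV[R]_4 => h v) E)).
    by rewrite /= dv psiy /U deriveE.
  have E2 : 'D_v (fun z => \val (A (s z))) y = diag_rot sg ta U.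
    rewrite deriveE //; have E := diff_comp ds (dA (\val (s y))).
    apply: (etrans (congr1 (fun h : 'rV[R]_3 -> 'rV[R]_4 => h v) E)).
    by rewrite /= diff_lin ?/U ?deriveE //; exact: rot_continuous.
  rewrite -E2 -E1; apply: near_eq_derive; apply: filterS lift_eq => z zE.
  by rewrite -zE.
have U0 : U != 0.
  apply: contra_neq v0 => U0; have := FK v; rewrite -/U U0 => <-; exact: derive0.
have dU : dot (\val x) U = 0 by have := section_tangent lVs v Vy; rewrite /= sy.
have sU : symp mu (\val x) U = 0.
  by have := lens_formE mu p_gt0 co_pq v Ac lVs Vy; rewrite av sy => <-.
have x1 := sphereP x; rewrite sqnormE in x1.
have /rot_fixed[x01 x23] : diag_rot sg ta (\val x) = \val x by rewrite -{2}Ax.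
have [U01 U23] := rot_fixed AU.
have inc := @period_incommensurable T k T0.
have m0 : mu^-1 != 0 by rewrite invr_eq0 gt_eqF.
(* A vector of the plane orthogonal to the unit vector (a,b) and to its quarter turn is zero. *)
have planar (a b u w : R) : a ^+ 2 + b ^+ 2 = 1 ->
    a * u + b * w = 0 -> a * w - b * u = 0 -> u = 0 /\ w = 0.
  move=> ab e1 e2; split.
    have : (a ^+ 2 + b ^+ 2) * u = a * (a * u + b * w) - b * (a * w - b * u) by ring.
    by rewrite ab e1 e2 mul1r !mulr0 subr0.
  have : (a ^+ 2 + b ^+ 2) * w = b * (a * u + b * w) + a * (a * w - b * u) by ring.
  by rewrite ab e1 e2 mul1r !mulr0 addr0.
move: dU sU; rewrite /dot /symp.
case: x01 => [c1|[z0 z1]].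
  case: x23 => [c2|[z2 z3]]; first by case: (inc c1 c2).
  case: U23 => [c2|[u2 u3]]; first by case: (inc c1 c2).
  rewrite z2 z3 u2 u3 !mul0r subrr mulr0 !addr0 => e1 e2.
  move: x1; rewrite z2 z3 expr0n /= !addr0 => x1.
  have [u0 u1] := planar _ _ _ _ x1 e1 e2.
  by case/eqP: U0; apply: eq_crd4; rewrite crd0.
case: x23 => [c2|[z2 z3]]; last first.
  by move: x1; rewrite z0 z1 z2 z3 expr0n /= !addr0 => /eqP; rewrite eq_sym oner_eq0.
case: U01 => [c1|[u0 u1]]; first by case: (inc c1 c2).
rewrite z0 z1 u0 u1 !mul0r subrr !add0r => e1 /eqP.
rewrite mulf_eq0 (negbTE m0) /= => /eqP e2.
move: x1; rewrite z0 z1 expr0n /= !add0r => x1.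
have [u2 u3] := planar _ _ _ _ x1 e1 e2.
by case/eqP: U0; apply: eq_crd4; rewrite crd0.
Qed.

End ClosedOrbits.

(** * Contractible loops *)

Section Contractible.
Context {R : realType}.
Variables (p q : nat).
Hypotheses (p_gt0 : (0 < p)%N) (co_pq : coprime p q).
Local Notation S3 := (sphere3 R).
Local Notation L := (lens_space R p q).
Local Notation proj := (@lens_proj R p q).
Local Notation d2 x y := (sqnorm (\val (x : S3) - \val (y : S3))).

Lemma d2_sym (x y : S3) : d2 x y = d2 y x.
Proof. by rewrite -sqnormN opprB. Qed.

Lemma d2_triangle (x y z : S3) : d2 x z <= 2 * (d2 x y + d2 y z).
Proof. by rewrite -(subrKA (\val y)); exact: sqnormD_le. Qed.

Lemma d2_deck k (x y : S3) : d2 (deck p q k x) (deck p q k y) = d2 x y.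
Proof. by rewrite !val_deck /lens_act -rotB sqnorm_rot. Qed.

(** Nearness in the quotient measured upstairs. Quantifying over all lifts of [m] lets a chain of
    lifts be continued from whichever lift has been reached. *)
Definition close (e : R) (m m' : L) :=
  forall z, proj z = m -> exists2 z', proj z' = m' & d2 z' z < e.

Lemma close_proj e (z z' : S3) : d2 z' z < e -> close e (proj z) (proj z').
Proof.
move=> zz' w /esym/projP[k ->]; exists (deck p q k z'); first exact: proj_deck.
by rewrite d2_deck.
Qed.

Local Notation square := (`[0, 1] `*` `[0, 1] : set (R * R)).

(** Uniform continuity by compactness of the square. The lift [gam] is treated together with [H] so
    that one mesh also serves for the chain on the bottom row. *)
Lemma homotopy_uniform (H : R * R -> L) (gam : R -> S3) (e : R) : 0 < e ->
  {within `[0, 1] `*` [set: R], continuous H} -> continuous gam ->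
  exists2 d, 0 < d & forall P P', square P -> square P' -> ball P d P' ->
    close e (H P) (H P') /\ d2 (gam P.2) (gam P'.2) < e.
Proof.
move=> e0 /subspace_continuousP cH cg; have e4 : 0 < e / 4 by rewrite divr_gt0.
have : compact square by apply: compact_setX; exact: segment_compact.
move=> /compact_near_coveringP/near_covering_withinP.
move=> /(_ R (0 : R)^'+ (fun d P => forall P', square P' -> ball P d P' ->
    close e (H P) (H P') /\ d2 (gam P.2) (gam P'.2) < e) _).
case=> [P [P1 P2]|d /= d0 Hd].
  have [z zE] := proj_surj (H P).
  have oB : nbhs (H P) (proj @` [set z' | d2 z' z < e / 4]).
    have : nbhs z [set z' | d2 z' z < e / 4] := near_sphere z e4.
    rewrite (@nbhsE S3) => -[B [oB Bz] BW].
    have nB : nbhs (H P) (proj @` B).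
      by apply: open_nbhs_nbhs; split; [apply lens_proj_open|rewrite zE; exists z].
    suff BW' : proj @` B `<=` proj @` [set z' | d2 z' z < e / 4].
      exact: filterS BW' nB.
    by move=> _ [z' /BW ? <-]; exists z'.
  have N1 : \forall P' \near P, (`[0, 1] `*` [set: R]) P' ->
     exists2 z', d2 z' z < e / 4 & proj z' = H P'.
    exact: cH (conj P1 I) _ oB.
  have N2 : \forall P' \near P, d2 (gam P'.2) (gam P.2) < e / 4.
    have c2 : {for P, continuous (gam \o snd)}.
      by apply: continuous_comp; [exact: cvg_snd|exact: cg].
    exact: c2 _ (near_sphere _ e4).
  have [r /= r0 Hr] := (nbhs_ballP _ _).1 (filterI N1 N2).
  have r2 : 0 < r / 2 by rewrite divr_gt0.
  exists (ball P (r / 2), [set d | d < r / 2]) => /=.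
    split; first exact: nbhsx_ballx.
    exact: nbhs_right_lt.
  move=> [P' d] /= [PP' dr] [P'1 P'2] P'' [P''1 P''2] P'P''.
  have Pr' : ball P r P' by apply: (@le_ball _ _ P (r / 2)) PP'; lra.
  have Pr'' : ball P r P''.
    apply: (@le_ball _ _ P (r / 2 + d)); first lra.
    exact: ball_triangle PP' P'P''.
  have [h1 g1] := Hr P' Pr'; have [h2 g2] := Hr P'' Pr''.
  have [z1 z1z <-] := h1 (conj P'1 I); have [z2 z2z <-] := h2 (conj P''1 I).
  split.
    apply: close_proj; apply: le_lt_trans (d2_triangle _ z _) _.
    by rewrite (d2_sym z z1); lra.
  apply: le_lt_trans (d2_triangle _ (gam P.2) _) _.
  by rewrite (d2_sym (gam P.2) (gam P''.2)); lra.
have dh0 : 0 < d / 2 by rewrite divr_gt0.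
exists (d / 2) => // P P' sP sP' PP'; apply: (Hd (d / 2)) => //=.
by rewrite sub0r normrN gtr0_norm //; lra.
Qed.

(** A discrete monodromy argument: the deck transformation joining the ends of a lift is carried
    from row to row of a fine grid, up to the constant loop, where freeness of the action makes it
    the identity. *)
Lemma contractible_lift_closed (gam : R -> S3) : continuous gam ->
  contractible_loop (fun t => proj (gam t)) -> gam 1 = gam 0.
Proof.
move=> cg [H [m [cH perH H0 H1]]].
have [rho rho0 gap] := @proj_gap R _ _ p_gt0 co_pq.
(* The longest comparison passes through [c' j], [c j] and [c j.+1] with a doubling at each step:
   2(e + 2(e + 2(e + e))) = 22 e. *)
pose e := rho / 22.
have e0 : 0 < e by rewrite divr_gt0.
have [d d0 unif] := homotopy_uniform e0 cH cg.
pose N := (Num.truncn d^-1).+1.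
have N0 : (0 : R) < N%:R by rewrite ltr0n.
have Nd : N%:R^-1 < d.
  by rewrite invf_plt ?posrE // truncnS_gt.
pose a (j : nat) : R := j%:R / N%:R.
have a01 j : (j <= N)%N -> a j \in `[0, 1].
  by move=> jN; rewrite in_itv /= divr_ge0 ?ler0n //= ler_pdivrMr // mul1r ler_nat.
have a0 : a 0 = 0 by rewrite /a mul0r.
have aN : a N = 1 by rewrite /a divff // gt_eqF.
have aS j : `|a j - a j.+1| < d.
  by rewrite distrC /a -mulrBl -natrB // subSnn mul1r gtr0_norm // invr_gt0.
have ad j : `|a j - a j| < d by rewrite subrr normr0.
have close_at i j i' j' : (i <= N)%N -> (j <= N)%N -> (i' <= N)%N -> (j' <= N)%N ->
    `|a i - a i'| < d -> `|a j - a j'| < d ->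
    close e (H (a i, a j)) (H (a i', a j')) /\ d2 (gam (a j)) (gam (a j')) < e.
  move=> iN jN i'N j'N ii' jj'; apply: (unif (a i, a j) (a i', a j')).
  - by split; exact: a01.
  - by split; exact: a01.
  - by split.
have [k0 k0E] : exists k, gam 1 = deck p q k (gam 0).
  apply/projP; rewrite -!H0 -[1 in RHS]add0r perH // lexx ler01 //.
(* On row [i] of the N x N grid, [c] is a chain of lifts with small steps; its
   holonomy [k0] is the same for all rows, and trivial on the constant last row. *)
suff [c [cP cS cN]] : exists c : nat -> S3,
    [/\ forall j, (j <= N)%N -> proj (c j) = H (a N, a j),
        forall j, (j < N)%N -> d2 (c j) (c j.+1) < e &
        c N = deck p q k0 (c 0%N)].
  have cst j : (j <= N)%N -> c j = c 0%N.
    elim: j => // j IH jN; rewrite -IH; last exact: ltnW.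
    apply/esym/gap; first by rewrite !cP ?(ltnW jN) // aN !H1.
    by apply: lt_trans (cS j jN) _; rewrite /e; lra.
  have := cst N (leqnn N); rewrite cN => /(deck_free p_gt0 co_pq) k0id.
  by rewrite k0E k0id.
have row i : (i <= N)%N -> exists c : nat -> S3,
    [/\ forall j, (j <= N)%N -> proj (c j) = H (a i, a j),
        forall j, (j < N)%N -> d2 (c j) (c j.+1) < e &
        c N = deck p q k0 (c 0%N)]; last exact: row.
elim: i => [_|i IH iN].
  exists (fun j => gam (a j)); split=> [j jN|j jN|].
  - by rewrite a0 H0.
  - by have [] := @close_at 0 j 0 j.+1 (leq0n _) (ltnW jN) (leq0n _) jN (ad 0) (aS j).
  - by rewrite aN a0.
have iN' := ltnW iN.
have [c [cP cS cN]] := IH iN'.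
have /choice[c' c'P] : forall j, exists z, (j <= N)%N ->
    proj z = H (a i.+1, a j) /\ d2 z (c j) < e.
  move=> j; have [jN|jN] := leqP j N; last by exists (gam 0).
  have [cl _] := @close_at i j i.+1 j iN' jN iN jN (aS i) (ad j).
  by have [z zE zc] := cl _ (cP j jN); exists z.
exists c'; split=> [j jN|j jN|].
- by have [] := c'P j jN.
- have jN' := ltnW jN.
  have [pj dj] := c'P j jN'; have [pj1 dj1] := c'P j.+1 jN.
  have [cl _] := @close_at i.+1 j i.+1 j.+1 iN jN' iN jN (ad _) (aS j).
  have [z zE zc] := cl _ pj.
  (* [close] supplies some lift near [c' j]; the gap identifies it with the one already chosen near
     [c j.+1]. *)
  suff <- : z = c' j.+1 by rewrite d2_sym.
  apply: gap; first by rewrite zE pj1.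
  have t1 := d2_triangle z (c' j) (c' j.+1).
  have t2 := d2_triangle (c' j) (c j) (c' j.+1).
  have t3 := d2_triangle (c j) (c j.+1) (c' j.+1).
  have := cS j jN; rewrite (d2_sym (c j.+1)) in t3; rewrite /e in zc dj dj1 *; lra.
- have [p0 d0'] := c'P 0%N (leq0n _); have [pN dN] := c'P N (leqnn _).
  (* By periodicity of [H] both ends lie over the same point, and both are near [c N], which is the
     translate of [c 0] by [k0]. *)
  apply: gap.
    rewrite proj_deck pN p0 aN a0 -[X in H (_, X)]add0r perH //.
    by have := a01 _ iN; rewrite in_itv.
  have t := d2_triangle (c' N) (c N) (deck p q k0 (c' 0%N)).
  have : d2 (c N) (deck p q k0 (c' 0%N)) < e by rewrite cN d2_deck d2_sym.
  rewrite /e in dN *; lra.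
Qed.

End Contractible.

(** * The two simple orbits *)

(** For nonzero integers, 2 divides [2 * a ^+ 2] to an odd power and [b ^+ 2] to an even one. *)
Lemma sqrt2_irrational (R : realType) (a b : int) :
  Num.sqrt (2 : R) * a%:~R = b%:~R -> a = 0.
Proof.
move=> ab; have : (2 * a ^+ 2)%:~R = (b ^+ 2)%:~R :> R.
  by rewrite intrM !rmorphXn /= -ab exprMn sqr_sqrtr.
move=> /intr_inj E.
have {E} : (2 * `|a| ^ 2 = `|b| ^ 2)%N by rewrite -!abszX -E abszM.
move: `|b|%N (absz_eq0 a) => n; move: `|a|%N => m ma E.
suff m0 : m = 0%N by apply/eqP; rewrite -ma m0.
have [->//|m0] := posnP m.
have n0 : (0 < n)%N.
  rewrite lt0n; apply: contraTneq m0 => n0; move: E; rewrite n0 => /eqP.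
  by rewrite muln_eq0 expn_eq0 /= andbT -leqn0 leqNgt.
have := congr1 (fun k => odd (logn 2 k)) E.
by rewrite /= lognM ?expn_gt0 ?m0 // !lognX oddD logn_prime // !oddM.
Qed.

Section CoreCircles.
Context {R : realType}.
Variables (p q : nat) (mu : R).
Hypotheses (p_gt0 : (0 < p)%N) (co_pq : coprime p q) (mu_gt0 : 0 < mu).
Local Notation S3 := (sphere3 R).
Local Notation proj := (@lens_proj R p q).
Local Notation flow := (@sflow R mu).
Local Notation ang1 k := (2 * pi * k%:~R / p%:R : R).
Local Notation ang2 k := (2 * pi * k%:~R * q%:R / p%:R : R).

Fact core1_subproof : row4 1 0 0 0 \in S3.
Proof.
apply/mem_set; rewrite /sphere3 /= -/(sqnorm _) sqnormE !crd_row4 //=; ring.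
Qed.

Fact core2_subproof : row4 0 0 1 0 \in S3.
Proof.
apply/mem_set; rewrite /sphere3 /= -/(sqnorm _) sqnormE !crd_row4 //=; ring.
Qed.

Definition core1 : S3 := exist (fun y => y \in S3) _ core1_subproof.
Definition core2 : S3 := exist (fun y => y \in S3) _ core2_subproof.

Lemma flow_core1 t : \val (flow t core1) = row4 (cos t) (sin t) 0 0.
Proof. by apply: eq_crd4; rewrite /= crd_rot // !crd_row4 //=; ring. Qed.

Lemma flow_core2 t : \val (flow t core2) = row4 0 0 (cos (mu * t)) (sin (mu * t)).
Proof. by apply: eq_crd4; rewrite /= crd_rot // !crd_row4 //=; ring. Qed.

Lemma deck_core1 k : \val (deck p q k core1) = row4 (cos (ang1 k)) (sin (ang1 k)) 0 0.
Proof. by apply: eq_crd4; rewrite /= crd_rot // !crd_row4 //=; ring. Qed.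

Lemma deck_core2 k : \val (deck p q k core2) = row4 0 0 (cos (ang2 k)) (sin (ang2 k)).
Proof. by apply: eq_crd4; rewrite /= crd_rot // !crd_row4 //=; ring. Qed.

Let p0 : p%:R != 0 :> R. Proof. by rewrite pnatr_eq0 -lt0n. Qed.

Lemma angle_congruence (s t : R) : cos s = cos t -> sin s = sin t ->
  exists m : int, s = t + 2 * pi * m%:~R.
Proof.
move=> cst sst; have /cos_eq1[m mE] : cos (s - t) = 1.
  by rewrite cosB cst sst -!expr2 cos2Dsin2.
by exists m; rewrite -mE addrC subrK.
Qed.

Lemma core1_period t : proj (flow t core1) = proj core1 <->
  exists j : int, t = 2 * pi / p%:R * j%:~R.
Proof.
split=> [/esym/projP[k /(congr1 val)]|[j jE]].
  rewrite flow_core1 deck_core1 => E.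
  have c0 := congr1 (crd^~ 0%N) E; have c1 := congr1 (crd^~ 1%N) E.
  rewrite !crd_row4 //= in c0 c1.
  have [m ->] := angle_congruence c0 c1.
  by exists (k + m * p%:Z); rewrite intrD intrM -pmulrn; field.
apply/esym/projP; exists j; apply/val_inj; rewrite flow_core1 deck_core1 jE.
by rewrite mulrAC.
Qed.

(** The generator of the deck group turns this circle by 2 pi q / p; as [q] is invertible modulo
    [p], some power turns it by 2 pi / p. *)
Lemma core2_period t : proj (flow t core2) = proj core2 <->
  exists j : int, t = 2 * pi / (p%:R * mu) * j%:~R.
Proof.
have mu0 : mu != 0 by rewrite gt_eqF.
split=> [/esym/projP[k /(congr1 val)]|[j jE]].
  rewrite flow_core2 deck_core2 => E.
  have c0 := congr1 (crd^~ 2%N) E; have c1 := congr1 (crd^~ 3%N) E.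
  rewrite !crd_row4 //= in c0 c1.
  have [m mE] := angle_congruence c0 c1.
  exists (k * q%:Z + m * p%:Z); rewrite -[LHS](mulKf mu0) mE.
  by rewrite intrD !intrM -!pmulrn; field; rewrite ?p0 ?mu0.
have [u [w uw]] : exists u w : int, u * p%:Z + w * q%:Z = 1.
  have [u [w]] := Bezoutz p%:Z q%:Z; rewrite (eqP (co_pq : coprimez p q)) => uw.
  by exists u, w.
(* [w] is the Bezout inverse of [q] modulo [p]; the remainder [u * p] contributes only full
   turns. *)
apply/esym/projP; exists (j * w); apply/val_inj.
rewrite flow_core2 deck_core2.
have -> : ang2 (j * w) = mu * t + 2 * pi * (- (j * u))%:~R.
  have wq : w%:~R * q%:R = 1 - u%:~R * p%:R :> R.
    have := congr1 (fun z : int => z%:~R : R) uw.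
    rewrite /= intrD !intrM -!pmulrn => E.
    by apply/eqP; rewrite eq_sym subr_eq addrC; apply/eqP/esym; exact: E.
  rewrite intrM mulrA -[_ * w%:~R * _]mulrA wq jE mulrNz intrM.
  by field; apply/andP; split; [exact: mu0|exact: p0].
by rewrite !(cos_sinD2piz _ _).1 !(cos_sinD2piz _ _).2.
Qed.

Lemma flow_to_core1 (x : S3) : crd (\val x) 2 = 0 -> crd (\val x) 3 = 0 ->
  exists b, x = flow b core1.
Proof.
move=> x2 x3; have := sphereP x; rewrite sqnormE x2 x3 expr0n /= !addr0.
move=> /angle_exists[b [c s]]; exists b; apply/val_inj; rewrite flow_core1.
by apply: eq_crd4; rewrite crd_row4 //= ?c ?s.
Qed.

Lemma flow_to_core2 (x : S3) : crd (\val x) 0 = 0 -> crd (\val x) 1 = 0 ->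
  exists b, x = flow b core2.
Proof.
move=> x0 x1; have := sphereP x; rewrite sqnormE x0 x1 expr0n /= !add0r.
move=> /angle_exists[b [c s]]; exists (b / mu); apply/val_inj; rewrite flow_core2.
have -> : mu * (b / mu) = b by rewrite mulrC divfK // gt_eqF.
by apply: eq_crd4; rewrite crd_row4 //= ?c ?s.
Qed.

Lemma core1_flow_fixed t : flow t core1 = core1 -> cos t = 1.
Proof.
by move=> /(congr1 (fun x => crd (\val x) 0)); rewrite flow_core1 !crd_row4.
Qed.

Lemma core2_flow_fixed t : flow t core2 = core2 -> cos (mu * t) = 1.
Proof.
by move=> /(congr1 (fun x => crd (\val x) 2)); rewrite flow_core2 !crd_row4.
Qed.

Lemma cores_disjoint t : proj (flow t core1) <> proj core2.
Proof.
move=> /projP[k /(congr1 (fun x => crd (\val x) 2))].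
rewrite val_deck /lens_act crd_rot // flow_core1 !crd_row4 //= !mulr0 subr0.
by move/eqP; rewrite oner_eq0.
Qed.

End CoreCircles.

Theorem proposition1p9 (R : realType) (p q : nat)
    (hpq : coprime p q) (hq : (1 <= q)%N) (hqp : (q < p)%N) :
  exists a : local_forms R (lens_space R p q) 3,
    [/\ contact_form (lens_atlas R p q) a,
        nondegenerate_form (lens_atlas R p q) a &
        exists (T1 T2 : R) (g1 g2 : R -> lens_space R p q),
          [/\ simple_closed_orbit (lens_atlas R p q) a T1 g1,
              simple_closed_orbit (lens_atlas R p q) a T2 g2,
              ~ same_orbit g1 g2,
              (forall (T : R) (g : R -> lens_space R p q),
                 simple_closed_orbit (lens_atlas R p q) a T g ->
                 same_orbit g1 g \/ same_orbit g2 g) &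
              [/\ nondegenerate_orbit (lens_atlas R p q) a T1 g1,
                  nondegenerate_orbit (lens_atlas R p q) a T2 g2,
                  ~ contractible_loop g1 &
                  ~ contractible_loop g2]]].
Proof.
have p_gt0 : (0 < p)%N by exact: leq_trans hqp.
have p_gt1 : (1 < p)%N by exact: leq_ltn_trans hqp.
pose mu : R := Num.sqrt 2.
have mu0 : 0 < mu by rewrite sqrtr_gt0.
have irr : forall a b : int, mu * a%:~R = b%:~R -> a = 0 := @sqrt2_irrational R.
exists (@lens_form R p q mu); split.
- exact: lens_contact_form.
- by move=> T g; exact: orbit_nondegenerate.
pose P1 : R := 2 * pi / p%:R; pose P2 : R := 2 * pi / (p%:R * mu).
have P10 : 0 < P1 by rewrite divr_gt0 ?mulr_gt0 ?pi_gt0 ?ltr0n.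
have P20 : 0 < P2 by rewrite divr_gt0 ?mulr_gt0 ?pi_gt0 ?ltr0n.
have H1 := @core1_period R p q mu p_gt0.
have H2 := @core2_period R p q mu p_gt0 hpq mu0.
have S1 := period_simple p_gt0 hpq mu0 P10 H1.
have S2 := period_simple p_gt0 hpq mu0 P20 H2.
(* This is where [p] above 1 is used: the lifted arcs turn by 2 pi / p, which is not a full turn. It
   serves both orbits, since [mu * P2] equals [P1]. *)
have cosP : cos P1 <> 1.
  move=> c1; have := @cos_ang1_eq1 R p p_gt0 1; rewrite mulr1 => /(_ c1).
  by rewrite dvdz1 absz_nat => /eqP p1; rewrite p1 in p_gt1.
do 2 eexists; exists (fun t => lens_proj p q (sflow mu (P1 * t) (@core1 R))).
exists (fun t => lens_proj p q (sflow mu (P2 * t) (@core2 R))).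
split; [exact: S1|exact: S2| | |].
- move=> [s /(_ 0)]; rewrite mulr0 sflow0 => /esym; exact: cores_disjoint.
- move=> T g sg; have [/(closed_orbit_flow p_gt0 hpq mu0)[x [k [T0 g0 _ xk]]] _] := sg.
  have fx : diag_rot (T - 2 * pi * k%:~R / p%:R)
      (mu * T - 2 * pi * k%:~R * q%:R / p%:R) (\val x) = \val x.
    have : deck p q (- k) (sflow mu T x) = x by rewrite xk deckD addNr deck0.
    rewrite /deck /sflow srotD => /(congr1 val) /= {2}<-; congr diag_rot;
      rewrite mulrNz; ring.
  have [[c1|[z0 z1]] [c2|[z2 z3]]] := rot_fixed fx.
  + by case: (period_incommensurable p_gt0 irr T0 c1 c2).
  + left; have [b xb] := flow_to_core1 mu z2 z3; rewrite xb in g0.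
    exact: (period_classify p_gt0 hpq mu0 P10 H1 sg g0).
  + right; have [b xb] := flow_to_core2 mu0 z0 z1; rewrite xb in g0.
    exact: (period_classify p_gt0 hpq mu0 P20 H2 sg g0).
  (* All coordinates vanish here, which no point of the sphere allows; the argument for the second
     circle covers the case as it stands. *)
  + right; have [b xb] := flow_to_core2 mu0 z0 z1; rewrite xb in g0.
    exact: (period_classify p_gt0 hpq mu0 P20 H2 sg g0).
split.
- exact: orbit_nondegenerate S1.1.
- exact: orbit_nondegenerate S2.1.
- move=> /(contractible_lift_closed p_gt0 hpq (@sflow_continuous _ mu _ _)).
  by rewrite mulr1 mulr0 sflow0 => /core1_flow_fixed.
- move=> /(contractible_lift_closed p_gt0 hpq (@sflow_continuous _ mu _ _)).
  rewrite mulr1 mulr0 sflow0 => /core2_flow_fixed E; apply: cosP; rewrite -[RHS]E.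
  congr cos; rewrite /P1 /P2; field; by rewrite gt_eqF //= pnatr_eq0 -lt0n p_gt0.
Qed.
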